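(* Fix integers $r\le n$ and a CW complex $X$. Then $\mathcal{T}_X$ is a functor from $\mathcal{OA}(r,n)$ to the homotopy category $\operatorname{Ho}(\mathbf{Top})$: identities are sent to identities and, for admissible weak maps $\tau:(M,l_M)\to(N,l_N)$ and $\sigma:(N,l_N)\to(L,l_L)$, one has $(\sigma\circ\tau)^*\simeq\sigma^*\circ\tau^*$. Furthermore, if $X$ carries a free action of a group $\Gamma$, then $\mathcal{T}_X$ is a functor from $\mathcal{OA}(r,n)$ to the $\Gamma$-equivariant homotopy category $\Gamma\text{-}\operatorname{Ho}(\mathbf{Top})$.
   Context: Matroids: $\operatorname{rk}_M$ rank function, $\mathcal{L}(M)$ lattice of flats ordered by inclusion, bottom $\hat0$, atoms = rank-one flats. A map $\tau:M\to N$ is a set map $E(M)\cup\{o\}\to E(N)\cup\{o\}$ fixing an adjoined loop $o$; $\tau^{\#}(X)=\operatorname{cl}_N(\tau(X)\setminus\{o\})$; $\tau$ is a weak map if $\operatorname{rk}_N(\tau(X)\setminus\{o\})\le\operatorname{rk}_M(X)$ for all $X$. $B_r$ = Boolean lattice on $[r]$; an immersion of a rank-$r$ matroid $M$ is $l:\mathcal{L}(M)\to B_r$ with $p\le q\Rightarrow l(p)\supseteq l(q)$ and $|l(p)|=r-\operatorname{rk}_M(p)$; a weak map $\tau:(M,l)\to(N,l')$ is admissible if $l(p)\subseteq l'(\tau^{\#}(p))$ for all $p$. $\mathcal{OA}(r,n)$ is the category whose objects are immersed rank-$r$ matroids on $n$-element ground sets and whose morphisms are admissible weak maps. For $\sigma\subseteq[r]$,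 $D_X(\sigma)$ is the join of copies of $X$ indexed by $\sigma$ ($D_X(\emptyset)=\emptyset$); $\mathcal{D}_X(M,l)$ is the $\mathcal{L}(M)$-diagram $p\mapsto D_X(l(p))$ with inclusions for $p\ge q$; its homotopy colimit is $\coprod_p(\Delta(\mathcal{L}(M)_{\le p})\times D_X(l(p)))/\sim$ glued along the inclusions ($\Delta$ = order complex), and $\mathcal{T}_X(M,l)=\bigcup_{a\text{ atom}}\operatorname{hocolim}_{\mathcal{L}(M)_{\ge a}}\mathcal{D}_X(M,l)$. For an admissible $\tau$, $\tau^*$ is the map of homotopy colimits $(\lambda_1p_1+\cdots+\lambda_kp_k,x)\mapsto(\lambda_1\tau^{\#}(p_1)+\cdots+\lambda_k\tau^{\#}(p_k),x)$ ($p_1\le\cdots\le p_k=p$, $x\in D_X(l(p))\subseteq D_X(l'(\tau^{\#}(p)))$); its restriction to $\mathcal{T}_X(M,l)$ is homotopic to a map into $\mathcal{T}_X(N,l')$, and $\mathcal{T}_X(\tau)$ is the homotopy class of this map. $\Gamma$ acts diagonally on joins and through the second factor on homotopy colimits.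
   Formalization: The class T_X(τ) is not uniquely determined, so functoriality reads: some choice of representatives homotopic to τ^* in the homotopy colimit is functorial, any representatives compose to one, and the composition law holds inside T_X whenever the maps τ^*, σ^*, (σ∘τ)^* restrict. *)

(* Defs.v *)
From HB Require Import structures.
From Stdlib Require Import Relations.Relation_Operators.
From mathcomp Require Import all_boot all_order all_algebra.

Set Implicit Arguments.
Unset Strict Implicit.
Unset Printing Implicit Defensive.

Record matroid (E : finType) := Matroid {
  rk : {set E} -> nat;
  rk_card : forall A : {set E}, (rk A <= #|A|)%N;
  rk_mono : forall A B : {set E}, A \subset B -> (rk A <= rk B)%N;
  rk_submod : forall A B : {set E},
    (rk (A :|: B) + rk (A :&: B) <= rk A + rk B)%N }.

Section Closure.
Variables (E : finType) (M : matroid E).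
Implicit Types A B F : {set E}.

Definition cl A : {set E} := [set e | rk M (e |: A) == rk M A].

Definition is_flat F : bool := cl F == F.

Lemma sub_cl A : A \subset cl A.
Proof.
apply/subsetP => e eA; rewrite inE; apply/eqP; congr rk.
by apply/setUidPr; rewrite sub1set.
Qed.

Lemma cl_add A B e : A \subset B -> e \in cl A -> rk M (e |: B) = rk M B.
Proof.
move=> AB; rewrite inE => /eqP eA; apply/eqP.
rewrite eqn_leq [X in _ && X]rk_mono ?subsetUr// andbT.
have := rk_submod M (e |: A) B.
rewrite -setUA (setUidPr AB) eA => h.
have h2 : (rk M A <= rk M ((e |: A) :&: B))%N.
  by apply: rk_mono; rewrite subsetI subsetUr.
rewrite -(leq_add2r (rk M A)) (leq_trans (leq_add (leqnn _) h2))//.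
by rewrite [leqRHS]addnC.
Qed.

Lemma rk_cl A : rk M (cl A) = rk M A.
Proof.
suff H (s : seq E) : all [in cl A] s -> rk M (A :|: [set:: s]) = rk M A.
  rewrite -{1}(setUidPr (sub_cl A)) -[X in A :|: X]set_enum.
  by apply: H; apply/allP => e; rewrite mem_enum.
elim: s => [_|e s IH /= /andP[eA sA]]; first by rewrite set_nil setU0.
rewrite set_cons setUCA (@cl_add A)// ?subsetUl//.
exact: IH.
Qed.

Lemma cl_mono A B : A \subset B -> cl A \subset cl B.
Proof.
by move=> AB; apply/subsetP => e eA; rewrite inE (cl_add AB eA).
Qed.

Lemma cl_flat A : is_flat (cl A).
Proof.
rewrite /is_flat eqEsubset sub_cl andbT; apply/subsetP => e.
rewrite !inE rk_cl => /eqP h; rewrite eqn_leq [X in _ && X]rk_mono ?subsetUr//.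
by rewrite andbT -[leqRHS]h rk_mono// setUS// sub_cl.
Qed.

Definition flat : finType := {F : {set E} | is_flat F}.

Definition fle (p q : flat) : bool := val p \subset val q.

Lemma fle_trans : transitive fle.
Proof. by move=> q p s; exact: subset_trans. Qed.

Definition flat_rk (p : flat) : nat := rk M (val p).

Definition is_atom (p : flat) : bool := flat_rk p == 1%N.

End Closure.

(* The adjoined loop [o] is [None]. *)

Section PointedMaps.
Variables (E E' : finType).

(* tau(A) without the loop [o] *)
Definition image_off (tau : option E -> option E') (A : {set E}) : {set E'} :=
  [set y | Some y \in [set tau (Some x) | x in A]].

Variables (M : matroid E) (N : matroid E').

Definition is_weak_map (tau : option E -> option E') : Prop :=
  tau None = None /\
  forall A : {set E}, (rk N (image_off tau A) <= rk M A)%N.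

Definition sharp (tau : option E -> option E') (p : flat M) : flat N :=
  Sub (cl N (image_off tau (val p))) (cl_flat N _).

End PointedMaps.
Arguments sharp {E E' M N} tau p.

Lemma image_off_mono (E E' : finType) (tau : option E -> option E')
    (A B : {set E}) :
  A \subset B -> image_off tau A \subset image_off tau B.
Proof.
move=> AB; apply/subsetP => y; rewrite !inE => /imsetP[x xA ->].
by apply: imset_f; exact: (subsetP AB).
Qed.

Lemma sharp_mono (E E' : finType) (M : matroid E) (N : matroid E') tau
    (p q : flat M) :
  fle p q -> fle (sharp (N := N) tau p) (sharp tau q).
Proof. by move=> pq; apply/cl_mono/image_off_mono. Qed.

Record immersion (E : finType) (M : matroid E) (r : nat) := Immersion {
  imm :> flat M -> {set 'I_r};
  imm_anti : forall p q : flat M, fle p q -> imm q \subset imm p;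
  imm_card : forall p : flat M, #|imm p| = (r - flat_rk p)%N }.

Record OA_obj (r n : nat) := OAObj {
  ground : finType;
  ground_card : #|ground| = n;
  mat : matroid ground;
  mat_rank : rk mat [set: ground] = r;
  lab : immersion mat r }.

Notation flats M := (flat (mat M)).

Record OA_mor (r n : nat) (M N : OA_obj r n) := OAMor {
  mor_fun :> option (ground M) -> option (ground N);
  mor_weak : is_weak_map (mat M) (mat N) mor_fun;
  mor_adm : forall p : flats M, lab M p \subset lab N (sharp mor_fun p) }.

Section Category.
Variables (r n : nat).

Lemma image_off_id (E : finType) (A : {set E}) : image_off id A = A.
Proof.
apply/setP => y; rewrite inE; apply/imsetP/idP => [[x xA [->]]//|yA].
by exists y.
Qed.

Lemma sharp_id (E : finType) (M : matroid E) (p : flat M) :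
  sharp (N := M) id p = p.
Proof. by apply/val_inj; rewrite /= image_off_id; exact/eqP/(valP p). Qed.

Lemma OA_id_weak (M : OA_obj r n) : is_weak_map (mat M) (mat M) id.
Proof. by split=> // A; rewrite image_off_id. Qed.

Lemma OA_id_adm (M : OA_obj r n) (p : flats M) :
  lab M p \subset lab M (sharp id p).
Proof. by rewrite sharp_id. Qed.

Definition OA_id (M : OA_obj r n) : OA_mor M M :=
  OAMor (OA_id_weak M) (@OA_id_adm M).

Lemma image_off_comp (E E' E'' : finType) (tau : option E -> option E')
    (sigma : option E' -> option E'') (A : {set E}) :
  sigma None = None ->
  image_off (sigma \o tau) A = image_off sigma (image_off tau A).
Proof.
move=> s0; apply/setP => z; rewrite !inE; apply/imsetP/imsetP.
  move=> [x xA]; rewrite /comp; case tx: (tau (Some x)) => [y|]; last first.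
    by rewrite s0.
  by move=> ->; exists y => //; rewrite inE; apply/imsetP; exists x.
by move=> [y]; rewrite inE => /imsetP[x xA yx] ->; exists x; rewrite //= -yx.
Qed.

Variables (M N L : OA_obj r n) (sigma : OA_mor N L) (tau : OA_mor M N).

Lemma OA_comp_weak : is_weak_map (mat M) (mat L) (sigma \o tau).
Proof.
have [t0 tw] := mor_weak tau; have [s0 sw] := mor_weak sigma.
split=> [|A]; first by rewrite /= t0.
by rewrite image_off_comp// (leq_trans (sw _)).
Qed.

Lemma sharp_comp (p : flats M) :
  fle (sharp (N := mat L) (sigma \o tau) p)
      (sharp sigma (sharp (N := mat N) tau p)).
Proof.
have [s0 _] := mor_weak sigma.
by rewrite /fle /= image_off_comp//; apply/cl_mono/image_off_mono/sub_cl.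
Qed.

Lemma OA_comp_adm (p : flats M) :
  lab M p \subset lab L (sharp (sigma \o tau) p).
Proof.
apply: subset_trans (mor_adm tau p) _.
by apply: subset_trans (mor_adm sigma _) (imm_anti _ (sharp_comp p)).
Qed.

Definition OA_comp : OA_mor M L := OAMor OA_comp_weak OA_comp_adm.

End Category.

From mathcomp Require Import generic_quotient.
From mathcomp Require Import all_classical all_reals topology normedtype.

Import Order.TTheory GRing.Theory Num.Theory.
Import numFieldNormedType.Exports.

Local Open Scope quotient_scope.
Local Open Scope classical_set_scope.
Local Open Scope ring_scope.

Section CW.
Variable (R : realType).

Definition disc (k : nat) : set 'rV[R]_k :=
  [set v | \sum_(i < k) v ord0 i ^+ 2 <= 1].
Definition open_disc (k : nat) : set 'rV[R]_k :=
  [set v | \sum_(i < k) v ord0 i ^+ 2 < 1].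
Arguments disc : clear implicits.
Arguments open_disc : clear implicits.

Record CW_structure (X : topologicalType) := CWStructure {
  cell : nat -> Type;
  char_map : forall k, cell k -> 'rV[R]_k -> X;
  open_cell := fun k (i : cell k) => char_map i @` open_disc k;
  CW_continuous : forall k (i : cell k),
    {within disc k, continuous (char_map i)};
  CW_homeo_inj : forall k (i : cell k) (u v : 'rV[R]_k),
    open_disc k u -> open_disc k v -> char_map i u = char_map i v -> u = v;
  CW_homeo_open : forall k (i : cell k) (U : set 'rV[R]_k),
    open U -> exists2 V : set X, open V &
      char_map i @` (U `&` open_disc k) = V `&` open_cell i;
  CW_cover : forall x : X, exists k (i : cell k), open_cell i x;
  CW_disjoint : forall k (i : cell k) k' (i' : cell k') (x : X),
    open_cell i x -> open_cell i' x ->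
    existT cell k i = existT cell k' i';
  CW_closure_finite : forall k (i : cell k),
    exists2 S : set {j & cell j}, finite_set S &
      forall v : 'rV[R]_k, disc k v -> ~ open_disc k v ->
      exists2 c : {j & cell j}, S c &
        (projT1 c < k)%N /\ open_cell (projT2 c) (char_map i v);
  CW_weak : forall A : set X,
    (forall k (i : cell k), closed (A `&` char_map i @` disc k)) -> closed A }.

Definition is_CW_complex (X : topologicalType) : Prop :=
  hausdorff_space X /\ inhabited (CW_structure X).

End CW.

Definition homotopy (R : realType) (A B : topologicalType) (f g : A -> B)
    (H : R * A -> B) : Prop :=
  [/\ {within `[0, 1]%classic `*` setT, continuous H},
      forall a, H (0, a) = f a & forall a, H (1, a) = g a].

Definition homotopic (R : realType) (A B : topologicalType) (f g : A -> B)
    : Prop :=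
  exists H : R * A -> B, homotopy f g H.

Record is_Gspace (G : groupType) (A : topologicalType) (act : G -> A -> A) :=
  IsGspace {
    act1 : forall a, act 1%g a = a;
    actM : forall g h a, act (g * h)%g a = act g (act h a);
    act_continuous : forall g, continuous (act g) }.

Definition free_action (G : groupType) (A : Type) (act : G -> A -> A) : Prop :=
  forall g a, act g a = a -> g = 1%g.

Definition equivariant (G : Type) (A B : Type) (actA : G -> A -> A)
    (actB : G -> B -> B) (f : A -> B) : Prop :=
  forall g a, f (actA g a) = actB g (f a).

Definition Ghomotopic (R : realType) (G : Type) (A B : topologicalType)
    (actA : G -> A -> A) (actB : G -> B -> B) (f g : A -> B) : Prop :=
  exists2 H : R * A -> B, homotopy f g H &
    forall s, 0 <= s <= 1 -> equivariant actA actB (fun a => H (s, a)).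

Section Join.
Variables (R : realType) (X : topologicalType) (r : nat).
Implicit Types sigma : {set 'I_r}.

(* Points of the join over [sigma] are formal convex combinations
   [\sum_(i in sigma) t_i x_i], [x_i] being irrelevant when [t_i = 0].  The
   coordinates [x_i] with [i \notin sigma] are carried along but always
   irrelevant, so that this is the quotient of (simplex on sigma) x X^sigma. *)
Definition pre_join sigma
    : set ({ptws 'I_r -> R} * {ptws 'I_r -> X})%type :=
  [set d | [/\ forall i, 0 <= d.1 i, \sum_(i < r) d.1 i = 1
             & forall i, i \notin sigma -> d.1 i = 0]].

Definition join_rel sigma (d e : pre_join sigma) : bool :=
  `[< (forall i, (val d).1 i = (val e).1 i) /\
      (forall i, (val d).1 i != 0 -> (val d).2 i = (val e).2 i) >].

Lemma join_rel_refl sigma : reflexive (@join_rel sigma).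
Proof. by move=> d; apply/asboolP. Qed.

Lemma join_rel_sym sigma : ssrbool.symmetric (@join_rel sigma).
Proof.
move=> d e; apply/asboolP/asboolP => -[h k]; split=> i //.
  by rewrite -h => /k.
by rewrite -h => /k.
Qed.

Lemma join_rel_trans sigma : ssrbool.transitive (@join_rel sigma).
Proof.
move=> e d f /asboolP[h k] /asboolP[h' k']; apply/asboolP; split=> i.
  by rewrite h.
by move=> di; rewrite k// k'// -h.
Qed.

Canonical join_equiv sigma :=
  EquivRel (@join_rel sigma) (@join_rel_refl sigma) (@join_rel_sym sigma)
    (@join_rel_trans sigma).

Definition join sigma : topologicalType :=
  quotient_topology {eq_quot (join_equiv sigma)}.

Definition to_join sigma (d : pre_join sigma) : join sigma :=
  \pi_{eq_quot (join_equiv sigma)} d.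

Definition of_join sigma (d : join sigma) : pre_join sigma :=
  repr (d : {eq_quot (join_equiv sigma)}).

Lemma of_joinK sigma : cancel (@of_join sigma) (@to_join sigma).
Proof. exact: reprK. Qed.

Lemma to_joinP sigma (d e : pre_join sigma) :
  reflect (to_join d = to_join e) (join_rel d e).
Proof. exact: (@eqmodP _ (join_equiv sigma)). Qed.

Lemma to_joinK sigma (d : pre_join sigma) : join_rel (of_join (to_join d)) d.
Proof. by apply/to_joinP; rewrite of_joinK. Qed.

Lemma pre_join_incl sigma sigma' (d : {ptws 'I_r -> R} * {ptws 'I_r -> X}) :
  sigma \subset sigma' -> d \in pre_join sigma -> d \in pre_join sigma'.
Proof.
move=> ss /set_mem[d0 d1 ds]; apply/mem_set; split=> // i /negP is'.
by apply/ds/negP => /(fintype.subsetP ss).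
Qed.

Definition pre_incl sigma sigma' (h : sigma \subset sigma')
    (d : pre_join sigma) : pre_join sigma' :=
  exist _ (val d) (pre_join_incl h (valP d)).

Definition join_incl sigma sigma' (h : sigma \subset sigma') (d : join sigma)
    : join sigma' :=
  to_join (pre_incl h (of_join d)).

Lemma join_inclE sigma sigma' (h : sigma \subset sigma') d :
  join_incl h (to_join d) = to_join (pre_incl h d).
Proof. by apply/to_joinP; have := to_joinK d. Qed.

Variables (G : Type) (act : G -> X -> X).

Definition diag_act (g : G) (d : {ptws 'I_r -> R} * {ptws 'I_r -> X})
    : {ptws 'I_r -> R} * {ptws 'I_r -> X} :=
  (d.1, fun i => act g (d.2 i)).

Lemma pre_join_act sigma (g : G) d :
  d \in pre_join sigma -> diag_act g d \in pre_join sigma.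
Proof. by move=> /set_mem[d0 d1 ds]; apply/mem_set. Qed.

Definition pre_act sigma (g : G) (d : pre_join sigma) : pre_join sigma :=
  exist _ (diag_act g (val d)) (pre_join_act g (valP d)).

Definition join_act sigma (g : G) (d : join sigma) : join sigma :=
  to_join (pre_act g (of_join d)).

Lemma join_actE sigma g (d : pre_join sigma) :
  join_act g (to_join d) = to_join (pre_act g d).
Proof.
apply/to_joinP; have /asboolP[h k] := to_joinK d.
by apply/asboolP; split=> i //= /k ->.
Qed.

Lemma join_act_incl sigma sigma' (h : sigma \subset sigma') g d :
  join_act g (join_incl h d) = join_incl h (join_act g d).
Proof.
rewrite -(of_joinK d) !(join_inclE, join_actE).
by apply/to_joinP/asboolP.
Qed.

End Join.

Lemma join_inclD (R : realType) (X : topologicalType) (r : nat)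
    (s1 s2 s3 : {set 'I_r}) (h12 : s1 \subset s2) (h23 : s2 \subset s3)
    (h13 : s1 \subset s3) (d : join R X s1) :
  join_incl h23 (join_incl h12 d) = join_incl h13 d.
Proof.
by rewrite -(of_joinK d) !join_inclE; apply/to_joinP/asboolP.
Qed.

Section Hocolim.
Variables (R : realType) (X : topologicalType) (r n : nat) (M : OA_obj r n).
Implicit Types p q : flats M.

(* The order complex of the interval below [p], in barycentric coordinates. *)
Definition order_complex_le p : set {ptws flats M -> R} :=
  [set w | [/\ forall q, 0 <= w q, \sum_q w q = 1,
               forall q, w q != 0 -> fle q p
             & forall q q', w q != 0 -> w q' != 0 -> fle q q' || fle q' q]].

Lemma order_complex_incl p q (w : {ptws flats M -> R}) :
  fle p q -> w \in order_complex_le p -> w \in order_complex_le q.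
Proof.
move=> pq /set_mem[w0 w1 wp wc]; apply/mem_set; split=> // q' /wp qp.
exact: fle_trans qp pq.
Qed.

Definition oc_incl p q (h : fle p q) (w : order_complex_le p)
    : order_complex_le q :=
  exist _ (val w) (order_complex_incl h (valP w)).

Definition pre_summand p : topologicalType :=
  (order_complex_le p * join R X (lab M p))%type.

Definition pre_hocolim : topologicalType := {p : flats M & pre_summand p}.

Definition pre_point p (w : order_complex_le p) (d : join R X (lab M p))
    : pre_hocolim :=
  existT pre_summand p (w, d).

Inductive glue_step : pre_hocolim -> pre_hocolim -> Prop :=
| GlueStep p q (h : fle q p) (w : order_complex_le q)
    (d : join R X (lab M p)) :
    glue_step (pre_point (oc_incl h w) d)
              (pre_point w (join_incl (imm_anti (lab M) h) d)).

Definition glue_rel (u v : pre_hocolim) : bool :=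
  `[< clos_refl_sym_trans _ glue_step u v >].

Lemma glue_refl : reflexive glue_rel.
Proof. by move=> u; apply/asboolP/rst_refl. Qed.

Lemma glue_sym : ssrbool.symmetric glue_rel.
Proof. by move=> u v; apply/asboolP/asboolP; exact: rst_sym. Qed.

Lemma glue_trans : ssrbool.transitive glue_rel.
Proof.
move=> v u w /asboolP uv /asboolP vw; apply/asboolP; exact: rst_trans uv vw.
Qed.

Canonical glue_equiv := EquivRel glue_rel glue_refl glue_sym glue_trans.

Definition hocolim : topologicalType := quotient_topology {eq_quot glue_equiv}.

Definition to_hocolim (u : pre_hocolim) : hocolim := \pi_{eq_quot glue_equiv} u.

Definition of_hocolim (z : hocolim) : pre_hocolim :=
  repr (z : {eq_quot glue_equiv}).

Lemma of_hocolimK : cancel of_hocolim to_hocolim.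
Proof. exact: reprK. Qed.

Lemma to_hocolimP u v :
  clos_refl_sym_trans _ glue_step u v <-> to_hocolim u = to_hocolim v.
Proof.
split=> [uv|/eqmodP/asboolP//]; first by apply/eqmodP/asboolP.
Qed.

(* The homotopy colimit over a set [Q] of flats, inside the whole one. *)
Definition hocolim_over (Q : set (flats M)) : set hocolim :=
  [set z | exists p (w : order_complex_le p) (d : join R X (lab M p)),
    [/\ Q p, forall q, val w q != 0 -> Q q & z = to_hocolim (pre_point w d)]].

Definition TX : set hocolim :=
  \bigcup_(a in [set a | is_atom a]) hocolim_over [set p | fle a p].

Definition TX_incl : TX -> hocolim := val.

Variables (G : Type) (act : G -> X -> X).

Definition pre_hocolim_act (g : G) (u : pre_hocolim) : pre_hocolim :=
  let: existT p (w, d) := u in pre_point w (join_act act g d).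

Definition hocolim_act (g : G) (z : hocolim) : hocolim :=
  to_hocolim (pre_hocolim_act g (of_hocolim z)).

Lemma hocolim_actE g u :
  hocolim_act g (to_hocolim u) = to_hocolim (pre_hocolim_act g u).
Proof.
have /to_hocolimP := of_hocolimK (to_hocolim u); rewrite /hocolim_act.
move: (of_hocolim _) => v; elim=> {u v} [_ _ [p q h w d]|u //|u v _ //|u v w _ -> _ ->//].
by apply/to_hocolimP/rst_step; rewrite /= join_act_incl.
Qed.

Lemma TX_act g z : z \in TX -> hocolim_act g z \in TX.
Proof.
move=> /set_mem[a atom_a [p [w [d [ap aw ->]]]]]; apply/mem_set.
by exists a => //; rewrite hocolim_actE; exists p, w, (join_act act g d).
Qed.

Definition T_act (g : G) (z : TX) : TX :=
  exist _ (hocolim_act g (val z)) (TX_act g (valP z)).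

End Hocolim.

Arguments order_complex_le R {r n M} p _.
Arguments TX R X {r n} M _.
Arguments TX_incl {R X r n M}.
Arguments T_act {R X r n M G} act g z.

Section Star.
Variables (R : realType) (X : topologicalType) (r n : nat).
Variables (M N : OA_obj r n) (tau : OA_mor M N).

Let tsharp : flats M -> flats N := sharp tau.

Definition push_weight (w : {ptws flats M -> R}) : {ptws flats N -> R} :=
  fun q' => \sum_(q | tsharp q == q') w q.

Lemma push_weight_supp (w : {ptws flats M -> R}) q' :
  push_weight w q' != 0 -> exists2 q, w q != 0 & q' = tsharp q.
Proof.
apply: contra_neqP => h; rewrite /push_weight big1// => q /eqP tq.
by apply/eqP/negPn/negP => wq; apply: h; exists q.
Qed.

Lemma push_order_complex p (w : {ptws flats M -> R}) :
  w \in order_complex_le R p -> push_weight w \in order_complex_le R (tsharp p).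
Proof.
move=> /set_mem[w0 w1 wp wc]; apply/mem_set; split.
- by move=> q; exact: sumr_ge0.
- by rewrite -w1 [RHS](partition_big tsharp xpredT).
- by move=> q' /push_weight_supp[q /wp qp ->]; exact: sharp_mono.
- move=> _ _ /push_weight_supp[q wq ->] /push_weight_supp[q' wq' ->].
  by case/orP: (wc _ _ wq wq') => qq; rewrite (sharp_mono (mat N) tau qq) ?orbT.
Qed.

Definition pre_star (u : pre_hocolim R X M) : pre_hocolim R X N :=
  let: existT p (w, d) := u in
  pre_point (exist _ (push_weight (val w)) (push_order_complex (valP w))
               : order_complex_le R (tsharp p))
            (join_incl (mor_adm tau p) d).

Definition star (z : hocolim R X M) : hocolim R X N :=
  to_hocolim (pre_star (of_hocolim z)).

Lemma starE u : star (to_hocolim u) = to_hocolim (pre_star u).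
Proof.
have /to_hocolimP := of_hocolimK (to_hocolim u); rewrite /star.
move: (of_hocolim _) => v; elim=> {u v} [_ _ [p q h w d]|u //|u v _ //|u v w _ -> _ ->//].
apply/to_hocolimP/rst_step => /=.
set w' := exist _ _ _; set w'' := exist _ _ _.
have hqp : fle (tsharp q) (tsharp p) by exact: sharp_mono.
have -> : w' = oc_incl hqp w'' by exact/val_inj.
rewrite (join_inclD _ _ (fintype.subset_trans (mor_adm tau p) (imm_anti (lab N) hqp))).
by rewrite -(join_inclD (mor_adm tau p) (imm_anti (lab N) hqp)).
Qed.

End Star.

Arguments star R X {r n M N} tau z.

Section InducedClass.
Variables (R : realType) (X : topologicalType) (r n : nat).
Variables (M N : OA_obj r n) (tau : OA_mor M N).

(* The maps T_X(M) -> T_X(N) in the homotopy class of the restriction of tau^*.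
   As tau^* need not send T_X(M) into T_X(N), this homotopy takes place in the
   homotopy colimit of [N]. *)
Definition TX_class (f : TX R X M -> TX R X N) : Prop :=
  continuous f /\ homotopic R (TX_incl \o f) (star R X tau \o TX_incl).

(* tau^* does send T_X(M) into T_X(N), and [f] is the induced map. *)
Definition TX_restriction (f : TX R X M -> TX R X N) : Prop :=
  forall z, TX_incl (f z) = star R X tau (TX_incl z).

Variables (G : groupType) (act : G -> X -> X).

Definition GTX_class (f : TX R X M -> TX R X N) : Prop :=
  [/\ continuous f, equivariant (T_act act) (T_act act) f
    & Ghomotopic R (T_act act) (hocolim_act act)
        (TX_incl \o f) (star R X tau \o TX_incl)].

End InducedClass.

(* Main.v *)
(** A point of the homotopy colimit is a pair [(w, d)] of a weight [w] on a chain
    of flats and a point [d] of a join.  If [f <= g] are monotone maps of flats,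
    moving the mass of a chain from [f] to [g], starting at its top element, keeps
    the support a chain; this prism homotopy compares [(sigma o tau)^*] with
    [sigma^* o tau^*], also inside [TX], and, with [f] constant at the bottom
    flat, contracts the homotopy colimit onto the full join [X^{*r}].  Since
    [tau^*] does not change [d], a map [TX M -> TX N] lies in the class of [tau^*]
    as soon as it changes the join coordinate only up to homotopy in [X^{*r}].

    On [TX] some slot of the join is empty.  Off the diagonal of [X^{*r}] the mass
    of a slot [j] can be spread over the lighter slots, which retracts onto the
    join over the slots other than [j].  Hence [X^{*(r-1)}] is a retract of every
    [TX M], and the non-isomorphisms, a two-sided ideal, can be sent to the maps
    [TX M -> X^{*(r-1)} -> TX N], while the isomorphisms are sent to a coherent
    system of isomorphisms inside each isomorphism class.  All formulas are
    natural in [X], hence equivariant. *)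

Require Import Defs.
From Stdlib Require Import Relations.Relation_Operators.
From mathcomp Require Import all_boot all_order all_algebra.
From mathcomp Require Import ring lra.
From mathcomp Require Import all_classical all_reals topology normedtype.

Set Implicit Arguments.
Unset Strict Implicit.
Unset Printing Implicit Defensive.

Import Order.TTheory GRing.Theory Num.Theory.
Import numFieldNormedType.Exports.

Local Open Scope classical_set_scope.
Local Open Scope ring_scope.

(** The obstacle is a mismatch of spaces. The class of [star] is defined by homotopies in the whole
    homotopy colimit of [N], which may pass through the bottom flat and so leave [TX], whereas
    functoriality asks for homotopies inside [TX]. Lying in the right classes therefore does not by
    itself make a family of maps functorial: the representatives have to be chosen with their
    composites in view. This is why everything passes through fixed representatives of isomorphism
    classes, and why the non-isomorphisms share one middle space: retraction after section is the
    identity on the nose, so two of them compose without further choices. A second obstacle is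
    topological. Joins and homotopy colimits carry quotient topologies, and a homotopy on them is
    checked on representatives; this is legitimate because the product of a quotient map with the
    line is again a quotient map. *)

(** * Continuity in product, subspace and quotient topologies *)

Lemma ptws_continuous (T K : topologicalType) (I : eqType)
    (f : T -> {ptws I -> K}) (t : T) :
  (forall i, {for t, continuous (fun u => f u i)}) -> {for t, continuous f}.
Proof.
move=> cf; apply/cvg_sup => i U [_ [[V oV <-]] Vt] /filterS; apply.
by apply: cf; exact: open_nbhs_nbhs.
Qed.

Lemma ptws_eval_continuous (K : topologicalType) (I : eqType) (i : I) :
  continuous (fun f : {ptws I -> K} => f i).
Proof. exact: (@proj_continuous _ (fun=> K)). Qed.

Lemma set_val_continuous (T : topologicalType) (A : set T) :
  continuous (val : A -> T).
Proof. exact: initial_continuous. Qed.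

Lemma continuous_set_type (T U : topologicalType) (A : set U) (f : T -> A) t :
  {for t, continuous (fun u => val (f u))} -> {for t, continuous f}.
Proof.
move=> cf W [_ [[V oV <-]] /= Vt] /filterS; apply; apply: cf.
exact: open_nbhs_nbhs.
Qed.

Lemma continuous_pair (T U V : topologicalType) (f : T -> U) (g : T -> V) t :
  {for t, continuous f} -> {for t, continuous g} ->
  {for t, continuous (fun x => (f x, g x))}.
Proof. by move=> cf cg; exact: cvg_pair. Qed.

Lemma continuous_compT (T U V : topologicalType) (f : T -> U) (g : U -> V) t :
  continuous g -> {for t, continuous f} -> {for t, continuous (fun x => g (f x))}.
Proof. by move=> cg cf; apply: continuous_comp; [exact: cf|exact: cg]. Qed.

Lemma continuous_minr (R : realType) (T : topologicalType) (f g : T -> R) t :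
  {for t, continuous f} -> {for t, continuous g} ->
  {for t, continuous (fun x => Num.min (f x) (g x))}.
Proof. exact: continuous_min. Qed.

Lemma continuous_maxr (R : realType) (T : topologicalType) (f g : T -> R) t :
  {for t, continuous f} -> {for t, continuous g} ->
  {for t, continuous (fun x => Num.max (f x) (g x))}.
Proof. exact: continuous_max. Qed.

Lemma continuous_subr (R : realType) (T : topologicalType) (f g : T -> R) t :
  {for t, continuous f} -> {for t, continuous g} ->
  {for t, continuous (fun x => f x - g x)}.
Proof. by move=> cf cg; exact: cvgB. Qed.

Lemma continuous_mulr (R : realType) (T : topologicalType) (f g : T -> R) t :
  {for t, continuous f} -> {for t, continuous g} ->
  {for t, continuous (fun x => f x * g x)}.
Proof. by move=> cf cg; exact: cvgM. Qed.

Lemma continuous_normr (R : realType) (T : topologicalType) (f : T -> R) t :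
  {for t, continuous f} -> {for t, continuous (fun x => `|f x|)}.
Proof. by move=> cf; exact: cvg_norm. Qed.

Lemma continuous_invr (R : realType) (T : topologicalType) (f : T -> R) t :
  f t != 0 -> {for t, continuous f} -> {for t, continuous (fun x => (f x)^-1)}.
Proof. by move=> ft cf; exact: cvgV. Qed.

Definition quotient_map (A B : topologicalType) (q : A -> B) : Prop :=
  (forall b, exists a, q a = b) /\ forall V, open (q @^-1` V) -> open V.

Lemma quotient_map_continuous (A B C : topologicalType) (q : A -> B)
    (f : B -> C) :
  quotient_map q -> continuous (f \o q) -> continuous f.
Proof.
by move=> [_ qo] /continuousP cf; apply/continuousP => V /cf; exact: qo.
Qed.

(* Whitehead: a tube around a compact neighbourhood in the line is saturated. *)
Lemma quotient_map_prod (R : realType) (A B : topologicalType) (q : A -> B) :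
  continuous q -> quotient_map q ->
  quotient_map (fun x : R * A => (x.1, q x.2)).
Proof.
move=> cq [qs qo]; split=> [[s b]|V oV].
  by have [a <-] := qs b; exists (s, a).
rewrite openE => -[s b] Vsb; have [a qa] := qs b.
have : nbhs (s, a) ((fun x : R * A => (x.1, q x.2)) @^-1` V).
  by apply: open_nbhs_nbhs; split=> //=; rewrite /= qa.
move=> [[P Q] /= [[e /= e0 eP] Qa] PQ].
pose K := `[s - e / 2, s + e / 2]%classic.
have e20 : 0 < e / 2 by rewrite divr_gt0.
have KP : K `<=` P.
  move=> u; rewrite /K /= in_itv /= => /andP[u1 u2]; apply: eP => /=.
  have : `|s - u| <= e / 2 by rewrite ler_norml lerBrDl lerBlDl; lra.
  by move=> /le_lt_trans; apply; rewrite ltr_pdivrMr// ltr_pMr// ltr1n.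
pose W := [set b' | forall u, K u -> V (u, b')].
have oW : open W.
  apply: qo; rewrite openE => a' Wa'.
  have /compact_near_coveringP cK : compact K by exact: segment_compact.
  apply: (cK _ _ (fun a u => V (u, q a))) => u /Wa' Vu.
  have [[P' Q'] /= [P'u Q'a] PQ'] : nbhs (u, a')
      ((fun x : R * A => (x.1, q x.2)) @^-1` V).
    by apply: open_nbhs_nbhs.
  by exists (P', Q') => // -[u' a''] /PQ'.
exists (K, W); last by move=> [u b'] /= [Ku]; apply.
split=> /=.
  exists (e / 2) => //= u /=; rewrite ltr_norml /K /= in_itv/=; lra.
apply: open_nbhs_nbhs; split=> // u /KP Pu; rewrite -qa.
by apply: (PQ (u, a)); split=> //=; exact: nbhs_singleton.
Qed.

(** Since [O] and its preimage are open, relatively open sets are open in the whole spaces, where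
    the quotient property of [q] applies. This allows maps defined only on an open part of a join to
    be checked on representatives. *)
Lemma quotient_map_open (A B : topologicalType) (q : A -> B) (O : set B)
    (qO : q @^-1` O -> O) :
  continuous q -> open O -> (forall a, val (qO a) = q (val a)) ->
  quotient_map q -> quotient_map qO.
Proof.
move=> cq oO qOE [qs qo]; split=> [b|V [U oU UV]].
  have [a qa] := qs (val b).
  have Oa : a \in q @^-1` O by apply/mem_set; rewrite /= qa; exact/set_mem/valP.
  by exists (exist _ a Oa); apply/val_inj; rewrite qOE.
exists (val @` V); last first.
  by rewrite eqEsubset; split=> [b [b' Vb'] /val_inj <-//|b Vb]; exists b.
apply: qo; suff -> : q @^-1` (val @` V) = U `&` q @^-1` O.
  by apply: openI => //; move/continuousP: cq; apply.
rewrite eqEsubset; split=> a.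
  move=> [b Vb qab]; have Oa : a \in q @^-1` O.
    by apply/mem_set; rewrite /= -qab; exact/set_mem/valP.
  split; last exact/set_mem.
  suff : (val @^-1` U) (exist _ a Oa : q @^-1` O) by [].
  rewrite UV /=; suff -> : qO (exist _ a Oa) = b by [].
  by apply/val_inj; rewrite qOE.
move=> [Ua /mem_set Oa]; exists (qO (exist _ a Oa)); last by rewrite qOE.
by have : (val @^-1` U) (exist _ a Oa : q @^-1` O) by []; rewrite UV.
Qed.

(** * Equivariant homotopies *)

Section Clamp.
Variable R : realType.
Implicit Types s : R.

Definition clamp s : R := Num.max 0 (Num.min s 1).

Lemma clamp_itv s : 0 <= clamp s <= 1.
Proof. by rewrite /clamp le_max lexx/= ge_max ler01 ge_min lexx orbT. Qed.

Lemma clamp_id s : 0 <= s <= 1 -> clamp s = s.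
Proof. by case/andP=> s0 s1; rewrite /clamp (min_idPl s1) (max_idPr s0). Qed.

Lemma clamp0 : clamp 0 = 0. Proof. by rewrite clamp_id// lexx ler01. Qed.
Lemma clamp1 : clamp 1 = 1. Proof. by rewrite clamp_id// lexx ler01. Qed.

Lemma clamp_continuous : continuous clamp.
Proof.
move=> s; apply: (@continuous_maxr _ _ (fun=> 0) (fun u : R => Num.min u 1)); first exact: cst_continuous.
by apply: (@continuous_minr _ _ id (fun=> 1)); [exact: cvg_id|exact: cst_continuous].
Qed.

End Clamp.

Section GHomotopy.
Variables (R : realType) (G : Type).
Implicit Types A B C : topologicalType.

Lemma Ghomotopic_of_continuous A B (aA : G -> A -> A) (aB : G -> B -> B)
    (f g : A -> B) (H : R * A -> B) :
  continuous H -> (forall a, H (0, a) = f a) -> (forall a, H (1, a) = g a) ->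
  (forall s, 0 <= s <= 1 -> equivariant aA aB (fun a => H (s, a))) ->
  Ghomotopic R aA aB f g.
Proof.
by move=> cH H0 H1 eH; exists H => //; split=> //; exact: continuous_subspaceT.
Qed.

(** Precomposing the time with [clamp] turns continuity within the slab over the unit interval into
    continuity on the whole line, and equivariance at times in the interval into equivariance at all
    times. Reparametrisations then need no side conditions. *)
Lemma Ghomotopic_total A B (aA : G -> A -> A) (aB : G -> B -> B)
    (f g : A -> B) :
  Ghomotopic R aA aB f g ->
  exists H : R * A -> B, [/\ continuous H, forall a, H (0, a) = f a,
    forall a, H (1, a) = g a & forall s, equivariant aA aB (fun a => H (s, a))].
Proof.
move=> [H [/subspace_continuousP cH H0 H1] eH].
exists (fun x => H (clamp x.1, x.2)); split=> [[s a]|a|a|s].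
- have cs : (`[0, 1]%classic `*` [set: A]) (clamp s, a).
    by split=> //=; rewrite in_itv/= clamp_itv.
  move=> V /(cH _ cs) [[P Q] /= [Pc Qa] PQ].
  exists (@clamp R @^-1` P, Q); first by split=> //; exact: clamp_continuous.
  move=> [s' a'] /= [Ps Qs]; apply: (PQ (clamp s', a')) => //.
  by split=> //=; rewrite in_itv/= clamp_itv.
- by rewrite /= clamp0.
- by rewrite /= clamp1.
- exact: eH (clamp_itv s).
Qed.

Lemma Ghomotopic_refl A B (aA : G -> A -> A) (aB : G -> B -> B) (f : A -> B) :
  continuous f -> equivariant aA aB f -> Ghomotopic R aA aB f f.
Proof.
move=> cf ef; apply: (@Ghomotopic_of_continuous _ _ _ _ _ _ (fun x => f x.2)) => //.
by move=> x; apply: continuous_comp; [exact: cvg_snd|exact: cf].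
Qed.

Lemma Ghomotopic_sym A B (aA : G -> A -> A) (aB : G -> B -> B) (f g : A -> B) :
  Ghomotopic R aA aB f g -> Ghomotopic R aA aB g f.
Proof.
move=> /Ghomotopic_total[H [cH H0 H1 eH]].
apply: (@Ghomotopic_of_continuous _ _ _ _ _ _ (fun x => H (1 - x.1, x.2))) => /=.
- move=> x; apply: (continuous_comp (f := fun x : R * A => (1 - x.1, x.2))).
    apply: continuous_pair; last exact: cvg_snd.
    by apply: cvgB; [exact: cvg_cst|exact: cvg_fst].
  exact: cH.
- by move=> a; rewrite subr0.
- by move=> a; rewrite subrr.
- by move=> s _; exact: eH.
Qed.

Lemma Ghomotopic_trans A B (aA : G -> A -> A) (aB : G -> B -> B)
    (f g h : A -> B) :
  Ghomotopic R aA aB f g -> Ghomotopic R aA aB g h -> Ghomotopic R aA aB f h.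
Proof.
move=> /Ghomotopic_total[H [cH H0 H1 eH]] /Ghomotopic_total[K [cK K0 K1 eK]].
pose L (x : R * A) := if x.1 <= 1 / 2 then H (x.1 * 2, x.2)
                      else K (x.1 * 2 - 1, x.2).
have cc (u v : R) (F : R * A -> B) : continuous F ->
    continuous (fun x : R * A => F (x.1 * u - v, x.2)).
  move=> cF x; apply: (continuous_comp (f := fun x : R * A => (x.1 * u - v, x.2))).
    apply: continuous_pair; last exact: cvg_snd.
    apply: cvgB; last exact: cvg_cst.
    by apply: cvgM; [exact: cvg_fst|exact: cvg_cst].
  exact: cF.
have cl (P : set R) : closed P -> closed (fst @^-1` P : set (R * A)).
  by move=> cP; apply: closed_comp => // x _; exact: cvg_fst.
apply: (@Ghomotopic_of_continuous _ _ _ _ _ _ L) => [|a|a|s _].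
- apply/continuous_subspace_setT.
  have -> : [set: R * A] = (fst @^-1` [set s | s <= 1 / 2])
      `|` (fst @^-1` [set s | 1 / 2 <= s]).
    rewrite eqEsubset; split=> // x _ /=.
    by case: (leP x.1 (1 / 2)) => [|/ltW] ?; [left|right].
  apply: withinU_continuous; [by apply: cl; exact: closed_le|by apply: cl; exact: closed_ge| |].
    apply: (subspace_eq_continuous (f := fun x : R * A => H (x.1 * 2 - 0, x.2))).
      by move=> x /set_mem xh; rewrite /from_subspace /L subr0 ifT.
    exact/continuous_subspaceT/cc.
  apply: (subspace_eq_continuous (f := fun x : R * A => K (x.1 * 2 - 1, x.2))).
    move=> x /set_mem xh; rewrite /from_subspace /L; case: ifPn => // xh'.
    have -> : x.1 = 1 / 2 by apply/le_anti; rewrite xh xh'.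
    by rewrite mul1r mulVf ?pnatr_eq0// subrr K0 H1.
  exact/continuous_subspaceT/cc.
- by rewrite /L /= mul0r ifT ?divr_ge0.
- rewrite /L /= ifF; last by apply/negbTE; rewrite -ltNge ltr_pdivrMr// mul1r ltr1n.
  by rewrite mul1r (_ : 2 - 1 = 1) ?K1//; ring.
- by move=> k a; rewrite /L /=; case: ifP => _; [exact: eH|exact: eK].
Qed.

Lemma Ghomotopic_postcomp A B C (aA : G -> A -> A) (aB : G -> B -> B)
    (aC : G -> C -> C) (f g : A -> B) (h : B -> C) :
  continuous h -> equivariant aB aC h ->
  Ghomotopic R aA aB f g -> Ghomotopic R aA aC (h \o f) (h \o g).
Proof.
move=> ch eh /Ghomotopic_total[H [cH H0 H1 eH]].
apply: (@Ghomotopic_of_continuous _ _ _ _ _ _ (h \o H)) => /=.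
- by move=> x; apply: continuous_comp; [exact: cH|exact: ch].
- by move=> a; rewrite H0.
- by move=> a; rewrite H1.
- by move=> s _ k a; rewrite eH eh.
Qed.

Lemma Ghomotopic_precomp A B C (aA : G -> A -> A) (aB : G -> B -> B)
    (aC : G -> C -> C) (f g : B -> C) (h : A -> B) :
  continuous h -> equivariant aA aB h ->
  Ghomotopic R aB aC f g -> Ghomotopic R aA aC (f \o h) (g \o h).
Proof.
move=> ch eh /Ghomotopic_total[H [cH H0 H1 eH]].
apply: (@Ghomotopic_of_continuous _ _ _ _ _ _ (fun x => H (x.1, h x.2))) => /=.
- move=> x; apply: (continuous_comp (f := fun x => (x.1, h x.2))); last exact: cH.
  apply: continuous_pair; first exact: cvg_fst.
  by apply: continuous_comp; [exact: cvg_snd|exact: ch].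
- by move=> a; rewrite H0.
- by move=> a; rewrite H1.
- by move=> s _ k a; rewrite eh eH.
Qed.

(** Equivariance over an empty type is vacuous, so ordinary homotopy is a special case. For this
    reason the homotopy lemmas take [G] to be a bare type. *)
Lemma homotopic_Ghomotopic A B (f g : A -> B) (aA : void -> A -> A)
    (aB : void -> B -> B) :
  homotopic R f g <-> Ghomotopic R aA aB f g.
Proof. by split=> [[H hH]|[H hH _]]; exists H => // s _ []. Qed.

End GHomotopy.

(** * Maps on coproducts, joins and homotopy colimits *)

Lemma sigT_prod_continuous (I : choiceType) (Y : I -> topologicalType)
    (T Z : topologicalType) (f : T * {i & Y i} -> Z) :
  (forall i, continuous (fun x : T * Y i => f (x.1, existT Y i x.2))) ->
  continuous f.
Proof.
move=> cf [t [i y]] U nU; have [[P Q] [Pt Qy] PQ] := cf i (t, y) U nU.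
exists (P, existT Y i @` Q); first by split=> //; exact: existT_nbhs.
by move=> [t' _] [/= Pt' [y' Qy' <-]]; exact: (PQ (t', y')).
Qed.

Lemma sigT_existT_continuous (I : choiceType) (Y : I -> topologicalType)
    (Z : topologicalType) (f : {i & Y i} -> Z) :
  (forall i, continuous (fun y => f (existT Y i y))) -> continuous f.
Proof. by move=> cf [i y] U nU; exact: (cf i y U nU). Qed.

Section JoinMaps.
Variables (R : realType) (X : topologicalType) (r : nat).
Implicit Types sigma : {set 'I_r}.

Lemma to_join_continuous sigma : continuous (@to_join R X r sigma).
Proof. exact: pi_continuous. Qed.

Lemma to_join_quotient sigma : quotient_map (@to_join R X r sigma).
Proof. by split=> // d; exists (of_join d); exact: of_joinK. Qed.

Lemma pre_join_weight_continuous sigma i :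
  continuous (fun d : @pre_join R X r sigma => (val d).1 i).
Proof.
move=> d.
apply: (continuous_compT (@ptws_eval_continuous R _ i)
  (f := fun d : @pre_join R X r sigma => (val d).1)).
apply: (continuous_compT (g := fst) (f := fun d : @pre_join R X r sigma => val d)).
  by move=> ?; exact: cvg_fst.
exact: set_val_continuous.
Qed.

Lemma pre_join_point_continuous sigma i :
  continuous (fun d : @pre_join R X r sigma => (val d).2 i).
Proof.
move=> d.
apply: (continuous_compT (@ptws_eval_continuous X _ i)
  (f := fun d : @pre_join R X r sigma => (val d).2)).
apply: (continuous_compT (g := snd) (f := fun d : @pre_join R X r sigma => val d)).
  by move=> ?; exact: cvg_snd.
exact: set_val_continuous.
Qed.

Lemma join_incl_continuous sigma sigma' (h : sigma \subset sigma') :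
  continuous (join_incl (R := R) (X := X) h).
Proof.
apply: (quotient_map_continuous (to_join_quotient sigma)) => d.
rewrite (_ : _ \o _ = @to_join R X r sigma' \o pre_incl h); last first.
  by apply/funext => e; exact: join_inclE.
apply: continuous_comp; last exact: to_join_continuous.
by apply: continuous_set_type => /=; exact: set_val_continuous.
Qed.

Lemma join_act_continuous (G : Type) (act : G -> X -> X) sigma g :
  continuous (act g) ->
  continuous (join_act (R := R) act (sigma := sigma) g).
Proof.
move=> cg; apply: (quotient_map_continuous (to_join_quotient sigma)) => d.
rewrite (_ : _ \o _ = @to_join R X r sigma \o pre_act act g); last first.
  by apply/funext => e; exact: join_actE.
apply: continuous_comp; last exact: to_join_continuous.
apply: continuous_set_type => /=; apply: continuous_pair.
  by apply: ptws_continuous => i; exact: pre_join_weight_continuous.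
apply: ptws_continuous => i.
apply: (continuous_compT cg (f := fun u : pre_join sigma => (val u).2 i)).
exact: pre_join_point_continuous.
Qed.

Lemma join_act1 (G : groupType) (act : G -> X -> X) sigma (d : join R X sigma) :
  is_Gspace act -> join_act act 1%g d = d.
Proof.
move=> [a1 _ _]; rewrite -(of_joinK d) join_actE; apply/to_joinP/asboolP.
by split=> // i _ /=; rewrite a1.
Qed.

Lemma join_actM (G : groupType) (act : G -> X -> X) sigma g h
    (d : join R X sigma) :
  is_Gspace act -> join_act act (g * h)%g d = join_act act g (join_act act h d).
Proof.
move=> [_ aM _]; rewrite -(of_joinK d) !join_actE; apply/to_joinP/asboolP.
by split=> // i _ /=; rewrite aM.
Qed.

End JoinMaps.

Section HocolimPoints.
Variables (R : realType) (X : topologicalType) (r n : nat) (M : OA_obj r n).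
Implicit Types (p q : flats M).

Lemma to_hocolim_continuous : continuous (@to_hocolim R X r n M).
Proof. exact: pi_continuous. Qed.

Lemma to_hocolim_quotient : quotient_map (@to_hocolim R X r n M).
Proof. by split=> // d; exists (of_hocolim d); exact: of_hocolimK. Qed.

(** One gluing step, with an arbitrary proof of the label inclusion and with weights compared only
    by value, so that later uses need no transport along the index flat. *)
Lemma hocolim_glue p q (h : fle q p) (k : lab M p \subset lab M q)
    (w : order_complex_le R p) (w' : order_complex_le R q)
    (d : join R X (lab M p)) : val w' = val w ->
  to_hocolim (pre_point w d) = to_hocolim (pre_point w' (join_incl k d)).
Proof.
move=> ww; have -> : w = oc_incl h w' by exact/val_inj.
rewrite (bool_irrelevance k (imm_anti (lab M) h)).
exact/to_hocolimP/rst_step.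
Qed.

Lemma hocolim_ind (P : hocolim R X M -> Prop) :
  (forall p (w : order_complex_le R p) (d : join R X (lab M p)),
    P (to_hocolim (pre_point w d))) -> forall z, P z.
Proof. by move=> hP z; rewrite -(of_hocolimK z); case: (of_hocolim z) => p [w d]; exact: hP. Qed.

Definition hweight (z : hocolim R X M) : {ptws flats M -> R} :=
  val (projT2 (of_hocolim z)).1.

Lemma hweightE p (w : order_complex_le R p) (d : join R X (lab M p)) :
  hweight (to_hocolim (pre_point w d)) = val w.
Proof.
have E u v : clos_refl_sym_trans _ (@glue_step R X r n M) u v ->
    val (projT2 u).1 = val (projT2 v).1.
  by elim=> {u v} // [_ _ []//|u v w' _ -> _ ->].
by rewrite /hweight (E _ (pre_point w d))//; apply/to_hocolimP; rewrite of_hocolimK.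
Qed.

(** The projection to the full join. Label inclusions compose, so it is invariant under gluing, just
    as the weight is. *)
Definition hjoin (z : hocolim R X M) : join R X [set: 'I_r]%SET :=
  join_incl (finset.subsetT _) (projT2 (of_hocolim z)).2.

Lemma hjoinE p (w : order_complex_le R p) (d : join R X (lab M p)) :
  hjoin (to_hocolim (pre_point w d)) = join_incl (finset.subsetT _) d.
Proof.
have E u v : clos_refl_sym_trans _ (@glue_step R X r n M) u v ->
    join_incl (finset.subsetT _) (projT2 u).2 =
    join_incl (finset.subsetT _) (projT2 v).2.
  elim=> {u v} // [_ _ [p' q h w' d']|u v w' _ -> _ ->//] /=.
  by rewrite (join_inclD _ _ (finset.subsetT _)).
by rewrite /hjoin (E _ (pre_point w d))//; apply/to_hocolimP; rewrite of_hocolimK.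
Qed.

Lemma hjoin_continuous : continuous hjoin.
Proof.
apply: (quotient_map_continuous to_hocolim_quotient).
apply: sigT_existT_continuous => p.
rewrite (_ : (fun y => _) = fun y : pre_summand R X p =>
    join_incl (finset.subsetT (lab M p)) y.2); last first.
  by apply/funext => -[w d]; exact: hjoinE.
move=> y; apply: (continuous_compT (f := snd)
  (@join_incl_continuous R X r _ _ (finset.subsetT (lab M p)))).
exact: cvg_snd.
Qed.

Lemma hjoin_act (G : Type) (act : G -> X -> X) g z :
  hjoin (hocolim_act act g z) = join_act act g (hjoin z).
Proof.
elim/hocolim_ind: z => p w d.
by rewrite hocolim_actE /= !hjoinE join_act_incl.
Qed.

Lemma fle_anti p q : fle p q -> fle q p -> p = q.
Proof. by move=> pq qp; apply/val_inj/eqP; rewrite finset.eqEsubset; exact/andP. Qed.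

Lemma supp_neq0 p (w : order_complex_le R p) : exists q, val w q != 0.
Proof.
have [_ w1 _ _] := set_mem (valP w); apply/not_existsP => h.
have : \sum_q val w q = 0 by rewrite big1// => q _; apply/eqP/negPn/negP => /h.
by rewrite w1 => /eqP; rewrite oner_eq0.
Qed.

(** The weight is an invariant of gluing, and an atom below a nonempty support is also below the
    index flat; hence membership is read off the support of any representative. *)
Lemma TXP p (w : order_complex_le R p) (d : join R X (lab M p)) :
  TX R X M (to_hocolim (pre_point w d)) <->
  exists2 a : flats M, is_atom a & forall q, val w q != 0 -> fle a q.
Proof.
split=> [[a /= aa [p' [w' [d' [ap aw /(congr1 hweight)]]]]]|[a aa aw]].
  by rewrite !hweightE => ww; exists a => // q; rewrite ww; exact: aw.
exists a => //; exists p, w, d; split=> //=.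
have [q wq] := supp_neq0 w; have [_ _ wp _] := set_mem (valP w).
exact: fle_trans (aw _ wq) (wp _ wq).
Qed.

End HocolimPoints.

Arguments hjoin {R X r n M} z.
Arguments hweight {R X r n M} z.

(** * The prism homotopy between two monotone maps of flats *)

Section Prism.
Variables (R : realType) (X : topologicalType) (r n : nat) (M N : OA_obj r n).
Variables f g : flats M -> flats N.
Hypothesis f_mono : forall p q, fle p q -> fle (f p) (f q).
Hypothesis g_mono : forall p q, fle p q -> fle (g p) (g q).
Hypothesis fg : forall p, fle (f p) (g p).
Hypothesis g_lab : forall p, lab M p \subset lab N (g p).
Implicit Types (p q : flats M) (w : {ptws flats M -> R}) (s : R).

(* The total mass of a chain is moved from [f] to [g] starting from its top
   element, so that the intermediate supports are again chains. *)
Definition moved s w q : R :=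
  Num.min (w q) (Num.max 0 (s - \sum_(q' | fle q q' && (q' != q)) w q')).

Definition prism_weight s w : {ptws flats N -> R} := fun q' : flats N =>
  \sum_(q | f q == q') (w q - moved s w q) + \sum_(q | g q == q') moved s w q.

Section Weights.
Variables (p : flats M) (w : {ptws flats M -> R}).
Hypothesis wp : w \in order_complex_le R p.

Let w0 q : 0 <= w q. Proof. by have [] := set_mem wp. Qed.

Lemma moved_ge0 s q : 0 <= moved s w q.
Proof. by rewrite /moved le_min w0 le_max lexx. Qed.

Lemma moved_le s q : moved s w q <= w q.
Proof. by rewrite /moved ge_min lexx. Qed.

Lemma moved0 q : moved 0 w q = 0.
Proof.
rewrite /moved (max_idPl _) ?(min_idPr _)// sub0r oppr_le0.
exact: sumr_ge0.
Qed.

Lemma moved1 q : moved 1 w q = w q.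
Proof.
apply/min_idPl; rewrite le_max; apply/orP; right.
have [_ <- _ _] := set_mem wp.
rewrite lerBrDr [leRHS](bigID (fun q' => fle q q' && (q' != q)))/= [leLHS]addrC lerD2l.
by rewrite (bigD1 q) ?eqxx ?andbF//= lerDl sumr_ge0.
Qed.

Lemma moved_supp s q : moved s w q != 0 -> w q != 0.
Proof. by apply: contra_neq => wq; have := moved_ge0 s q; have := moved_le s q; lra. Qed.

Lemma unmoved_supp s q : w q - moved s w q != 0 -> w q != 0.
Proof. by apply: contra_neq => wq; have := moved_ge0 s q; have := moved_le s q; lra. Qed.

(** Some mass stays at [q] only if [s] is less than the mass at and above [q]; some mass leaves [q']
    only if [s] exceeds the mass strictly above [q']. If [q'] were strictly below [q], the second
    mass would be at least the first. *)
Lemma moved_comparable s q q' :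
  w q - moved s w q != 0 -> moved s w q' != 0 -> fle q q'.
Proof.
move=> wq wq'; have [_ _ _ wc] := set_mem wp.
have [//|q'q] := orP (wc _ _ (unmoved_supp wq) (moved_supp wq')).
have [<-|nqq] := eqVneq q q'; first exact: subxx.
have lt1 : s < \sum_(q1 | fle q q1 && (q1 != q)) w q1 + w q.
  rewrite -ltrBlDl ltNge; apply: contraNN wq => h; rewrite subr_eq0 eq_sym.
  by apply/eqP/min_idPl; rewrite le_max h orbT.
have lt2 : \sum_(q1 | fle q' q1 && (q1 != q')) w q1 < s.
  rewrite -subr_gt0 ltNge; apply: contraNN wq' => h; apply/eqP.
  by rewrite /moved (max_idPl h) (min_idPr (w0 _)).
suff : \sum_(q1 | fle q q1 && (q1 != q)) w q1 + w q <=
       \sum_(q1 | fle q' q1 && (q1 != q')) w q1.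
  by rewrite leNgt (lt_trans lt2 lt1).
rewrite [leRHS](bigD1 q) ?q'q//= [leLHS]addrC lerD2l.
rewrite [leRHS](bigID (fun q1 => fle q q1 && (q1 != q)))/=.
rewrite (eq_bigl (fun q1 => [&& fle q' q1 && (q1 != q'), q1 != q & fle q q1 && (q1 != q)])).
  by under [in leRHS]eq_bigl do rewrite -andbA; rewrite lerDl sumr_ge0.
move=> q1; case: (boolP (fle q q1)) => qq1 /=; last by rewrite !andbF.
case: eqVneq => [->|q1q] /=; first by rewrite !andbF.
rewrite andbT (fle_trans q'q qq1) /=; apply/esym; apply: contra_neq q1q => q1q'.
by apply: fle_anti => //; rewrite q1q'.
Qed.

Lemma prism_weight_supp s (q' : flats N) : prism_weight s w q' != 0 ->
  (exists2 q, w q - moved s w q != 0 & q' = f q) \/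
  (exists2 q, moved s w q != 0 & q' = g q).
Proof.
move=> h; have [|h1] := pselect (exists q, w q - moved s w q != 0 /\ q' = f q).
  by move=> [q [? ?]]; left; exists q.
have [|h2] := pselect (exists q, moved s w q != 0 /\ q' = g q).
  by move=> [q [? ?]]; right; exists q.
move: h; rewrite /prism_weight !big1 ?addr0 ?eqxx// => q /eqP qq.
  by apply/eqP/negPn/negP => k; apply: h2; exists q.
by apply/eqP/negPn/negP => k; apply: h1; exists q.
Qed.

Lemma prism_order_complex s :
  prism_weight s w \in order_complex_le R (g p).
Proof.
have [_ w1 wle wc] := set_mem wp; apply/mem_set; split.
- move=> q; rewrite addr_ge0// sumr_ge0// => q1 _; last exact: moved_ge0.
  by rewrite subr_ge0 moved_le.
- have E (h : flats M -> flats N) (F : flats M -> R) :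
      \sum_q' \sum_(q | h q == q') F q = \sum_q F q.
    by rewrite [RHS](partition_big h xpredT).
  rewrite big_split /= -w1 !E -big_split /=.
  by apply: eq_bigr => q _; rewrite subrK.
- move=> q' /prism_weight_supp[[q /unmoved_supp/wle qp ->]|[q /moved_supp/wle qp ->]].
    exact: fle_trans (f_mono qp) (fg p).
  exact: g_mono.
- move=> q1 q2 /prism_weight_supp[] [q hq ->] /prism_weight_supp[] [q' hq' ->].
  + have /orP[] := wc _ _ (unmoved_supp hq) (unmoved_supp hq') => /f_mono ->//.
    by rewrite orbT.
  (* The mixed pair: [f q] lies below [f q'], which lies below [g q']. *)
  + by rewrite (fle_trans (f_mono (moved_comparable hq hq')) (fg q')).
  + by rewrite (fle_trans (f_mono (moved_comparable hq' hq)) (fg q)) orbT.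
  + have /orP[] := wc _ _ (moved_supp hq) (moved_supp hq') => /g_mono ->//.
    by rewrite orbT.
Qed.

End Weights.

(** The index flat is [g p] at all times, since every intermediate support lies below it; thus the
    label condition is imposed on [g]. *)
Definition pre_prism s (u : pre_hocolim R X M) : pre_hocolim R X N :=
  let: existT p (w, d) := u in
  pre_point (exist _ (prism_weight s (val w)) (prism_order_complex (valP w) s)
               : order_complex_le R (g p))
            (join_incl (g_lab p) d).

Definition prism (x : R * hocolim R X M) : hocolim R X N :=
  to_hocolim (pre_prism x.1 (of_hocolim x.2)).

Lemma prismE s u : prism (s, to_hocolim u) = to_hocolim (pre_prism s u).
Proof.
have /to_hocolimP := of_hocolimK (to_hocolim u); rewrite /prism /=.
move: (of_hocolim _) => v; elim=> {u v} [_ _ [p q h w d]|u //|u v _ //|u v w _ -> _ ->//] /=.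
rewrite (@hocolim_glue _ _ _ _ _ (g p) (g q) (g_mono h) (imm_anti (lab N) (g_mono h))
  _ (exist _ (prism_weight s (val w)) (prism_order_complex (valP w) s)))//.
rewrite (join_inclD _ _ (fintype.subset_trans (g_lab p) (imm_anti (lab N) (g_mono h)))).
by rewrite -(join_inclD (imm_anti (lab M) h) (g_lab q)).
Qed.

Lemma oc_eval_continuous p q :
  continuous (fun w : order_complex_le R p => val w q).
Proof.
move=> w; apply: (continuous_compT (@ptws_eval_continuous R _ q)
  (f := fun w : order_complex_le R p => val w)).
exact: set_val_continuous.
Qed.

Lemma moved_continuous p q :
  continuous (fun x : R * order_complex_le R p => moved x.1 (val x.2) q).
Proof.
have cw q' : continuous (fun x : R * order_complex_le R p => val x.2 q').
  move=> x; apply: (continuous_compT (@oc_eval_continuous p q') (f := snd)).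
  exact: cvg_snd.
pose above (x : R * order_complex_le R p) : R :=
  x.1 - \sum_(q' | fle q q' && (q' != q)) val x.2 q'.
move=> x; apply: (@continuous_minr _ _ (fun x : R * order_complex_le R p => val x.2 q)
  (fun x => Num.max 0 (above x))); first exact: cw.
apply: (@continuous_maxr _ _ (fun=> 0) above); first exact: cst_continuous.
apply: cvgB; first exact: cvg_fst.
by apply: (continuous_big add_continuous) => q' _; exact: cw.
Qed.

Lemma prism_continuous : continuous prism.
Proof.
have qm := @quotient_map_prod R _ _ _
  (@to_hocolim_continuous R X r n M) (@to_hocolim_quotient R X r n M).
apply: (quotient_map_continuous qm).
apply: sigT_prod_continuous => p.
pose F (x : R * pre_summand R X p) : pre_summand R X (g p) :=
  (exist _ (prism_weight x.1 (val x.2.1)) (prism_order_complex (valP x.2.1) x.1)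
     : order_complex_le R (g p), join_incl (g_lab p) x.2.2).
rewrite (_ : (fun x => _) = fun x => to_hocolim (existT _ (g p) (F x))); last first.
  by apply/funext => -[s [w d]]; rewrite /= prismE.
have c2 : continuous (fun x : R * pre_summand R X p => x.2) by move=> ?; exact: cvg_snd.
have cp (U V : topologicalType) : continuous (@fst U V) by move=> ?; exact: cvg_fst.
have cs (U V : topologicalType) : continuous (@snd U V) by move=> ?; exact: cvg_snd.
move=> x; apply: (continuous_compT (@to_hocolim_continuous R X r n N)
   (f := fun x => existT _ (g p) (F x))).
apply: (continuous_compT (@existT_continuous _ _ (g p)) (f := F)).
apply: continuous_pair; last first.
  apply: (continuous_compT (@join_incl_continuous R X r _ _ (g_lab p))
    (f := fun x : R * pre_summand R X p => x.2.2)).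
  by apply: (continuous_compT (cs _ _) (f := snd)); exact: cs.
apply: continuous_set_type => /=; apply: ptws_continuous => q'.
have cm q : {for x, continuous (fun x : R * pre_summand R X p => moved x.1 (val x.2.1) q)}.
  apply: (continuous_compT (@moved_continuous p q)
    (f := fun x : R * pre_summand R X p => (x.1, x.2.1))).
  apply: continuous_pair; first exact: cp.
  by apply: (continuous_compT (cp _ _) (f := snd)); exact: cs.
rewrite /prism_weight; apply: cvgD.
  apply: (cvg_big (@add_continuous R)) => q _; apply: cvgB; last exact: cm.
  apply: (continuous_compT (@oc_eval_continuous p q)
    (f := fun x : R * pre_summand R X p => x.2.1)).
  by apply: (continuous_compT (cp _ _) (f := snd)); exact: cs.
by apply: (cvg_big (@add_continuous R)) => q _; exact: cm.
Qed.

Lemma prism_equivariant (G : Type) (act : G -> X -> X) s :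
  equivariant (hocolim_act act) (hocolim_act act) (fun z => prism (s, z)).
Proof.
move=> k; elim/hocolim_ind => p w d.
by rewrite hocolim_actE !prismE hocolim_actE /= join_act_incl.
Qed.

(** At time 0 the support is the full [f]-image of the support of the weight. An atom below all of
    it is below the corresponding values of [g] too, hence below every later support. *)
Lemma prism_TX s z :
  TX R X N (prism (0, z)) -> TX R X N (prism (s, z)).
Proof.
elim/hocolim_ind: z => p w d; rewrite !prismE => /TXP[a aa /= wa]; apply/TXP.
exists a => //= q'; have [w0 _ _ _] := set_mem (valP w).
have af q : val w q != 0 -> fle a (f q).
  move=> wq; apply: wa; rewrite /prism_weight.
  under eq_bigr do rewrite (moved0 (valP w)) subr0.
  rewrite [X in _ + X]big1 ?addr0; last by move=> q1 _; rewrite (moved0 (valP w)).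
  rewrite (bigD1 q)//=; apply/lt0r_neq0/ltr_pwDl; last first.
    by apply: sumr_ge0 => q1 _; exact: w0.
  by rewrite lt_neqAle eq_sym wq w0.
move=> /prism_weight_supp[] [q hq ->].
  exact/af/(unmoved_supp (valP w) hq).
by apply: fle_trans (fg q); exact/af/(moved_supp (valP w) hq).
Qed.

End Prism.

(** * The bottom flat and atoms *)

Section Flats.
Variables (E : finType) (M : matroid E).

Lemma rk_set0 : rk M finset.set0 = 0%N.
Proof. by apply/eqP; rewrite -leqn0 (leq_trans (rk_card M _))// cards0. Qed.

Definition bot_flat : flat M := Sub (cl M finset.set0) (cl_flat M _).

Lemma bot_flat_rk : flat_rk bot_flat = 0%N.
Proof. by rewrite /flat_rk /= rk_cl rk_set0. Qed.

Lemma cl_flatE (p : flat M) : cl M (val p) = val p.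
Proof. exact/eqP/(valP p). Qed.

Lemma cl_sub_flat (A : {set E}) (p : flat M) :
  A \subset val p -> cl M A \subset val p.
Proof. by move=> /(cl_mono M); rewrite cl_flatE. Qed.

Lemma bot_fle (p : flat M) : fle bot_flat p.
Proof. by apply: cl_sub_flat; exact: finset.sub0set. Qed.

(** If all elements of [p] were loops, [p] would lie in the closure of the empty set and have rank
    0. The closure of a non-loop in [p] is the atom. *)
Lemma atom_below (p : flat M) : flat_rk p != 0%N ->
  exists2 a : flat M, is_atom a & fle a p.
Proof.
move=> rp; have [e ep re] : exists2 e, e \in val p & rk M [set e]%SET != 0%N.
  apply/exists2P/not_existsP => h; move/eqP: rp; apply; apply/eqP.
  have /(rk_mono M) : val p \subset cl M finset.set0.
    apply/fintype.subsetP => e ep; rewrite inE finset.setU0 rk_set0.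
    by apply/negPn/negP => re; apply: (h e).
  by rewrite rk_cl rk_set0 leqn0.
exists (Sub (cl M [set e]%SET) (cl_flat M _)).
  rewrite /is_atom /flat_rk /= rk_cl eqn_leq lt0n re andbT.
  by rewrite (leq_trans (rk_card M _))// cards1.
by apply: cl_sub_flat; rewrite finset.sub1set.
Qed.

End Flats.

(** * The maps of homotopy colimits and their composites *)

Section Stars.
Variables (R : realType) (X : topologicalType) (r n : nat).
Implicit Types (M N L : OA_obj r n).

Section OneStar.
Variables (M N : OA_obj r n) (tau : OA_mor M N).
Let sm (p q : flats M) (h : fle p q) : fle (sharp tau p) (sharp tau q) := sharp_mono (mat N) tau h.
Let srefl (p : flats M) : fle (sharp (N := mat N) tau p) (sharp tau p) := subxx _.

(** The start [f] is left free: it is [sharp tau] itself for the continuity of [star], and constant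
    at the bottom flat for the collapse. *)
Lemma prism_at1 (f : flats M -> flats N)
    (f_mono : forall p q, fle p q -> fle (f p) (f q))
    (f_le : forall p, fle (f p) (sharp tau p)) z :
  prism (R := R) (X := X) f_mono sm f_le (mor_adm tau) (1, z) = star R X tau z.
Proof.
elim/hocolim_ind: z => p w d; rewrite prismE starE /=; congr (to_hocolim (pre_point _ _)).
apply/val_inj/funext => q' /=; rewrite /prism_weight /push_weight big1 ?add0r.
  by apply: eq_bigr => q _; exact: (moved1 (valP w)).
by move=> q _; rewrite (moved1 (valP w)) subrr.
Qed.

Lemma prism_at0 (g : flats M -> flats N)
    (g_mono : forall p q, fle p q -> fle (g p) (g q))
    (g_ge : forall p, fle (sharp tau p) (g p))
    (g_lab : forall p, lab M p \subset lab N (g p)) z :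
  prism (R := R) (X := X) sm g_mono g_ge g_lab (0, z) = star R X tau z.
Proof.
elim/hocolim_ind: z => p w d; rewrite prismE starE /=.
(* The prism carries the index [g p] even at time 0; one gluing step lowers it to [sharp tau p]. *)
rewrite -(join_inclD (g_lab p) (imm_anti (lab N) (g_ge p)) (mor_adm tau p)).
apply: hocolim_glue (g_ge p) _ _ _ _ _ => /=.
apply/funext => q' /=; rewrite /prism_weight /push_weight [X in _ + X]big1 ?addr0.
  by apply: eq_bigr => q _; rewrite (moved0 (valP w)) subr0.
by move=> q _; exact: (moved0 (valP w)).
Qed.

Lemma star_continuous : continuous (star R X tau).
Proof.
(* [star] is the end of the prism from [sharp tau] to itself. *)
have cp := @prism_continuous R X r n M N _ _ sm sm srefl (mor_adm tau).
rewrite (_ : star R X tau = fun z => prism sm sm srefl (mor_adm tau) (1, z)); last first.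
  by apply/funext => z; rewrite prism_at1.
move=> z.
apply: (continuous_compT cp (f := fun z : hocolim R X M => (1, z) : R * hocolim R X M)).
by apply: continuous_pair; [exact: cst_continuous|exact: cvg_id].
Qed.

Lemma star_equivariant (G : Type) (act : G -> X -> X) :
  equivariant (hocolim_act act) (hocolim_act act) (star R X tau).
Proof.
move=> k; elim/hocolim_ind => p w d.
by rewrite hocolim_actE !starE hocolim_actE /= join_act_incl.
Qed.

Lemma hjoin_star z : hjoin (star R X tau z) = hjoin z.
Proof.
elim/hocolim_ind: z => p w d; rewrite starE !hjoinE /=.
exact: join_inclD.
Qed.

(** Suffices for [star] to preserve [TX]: the image of an atom below a support then still has an
    atom below it. *)
Definition keeps_positive_rank : Prop :=
  forall p : flats M, flat_rk p != 0%N -> flat_rk (sharp (N := mat N) tau p) != 0%N.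

Lemma star_TX z : keeps_positive_rank ->
  z \in TX R X M -> star R X tau z \in TX R X N.
Proof.
move=> kt /set_mem; elim/hocolim_ind: z => p w d /TXP[a /eqP aa wa].
have [|b bb ba] := @atom_below _ _ (sharp (N := mat N) tau a).
  by apply: kt; rewrite aa.
apply/mem_set; rewrite starE; apply/TXP; exists b => // q' /push_weight_supp[q wq ->].
exact: fle_trans ba (sm (wa _ wq)).
Qed.

End OneStar.

Lemma star_id M : star R X (OA_id M) = idfun.
Proof.
apply/funext; elim/hocolim_ind => p w d; rewrite starE /=.
have -> : w = exist _ (val w) (valP w) by exact/val_inj.
apply/esym/hocolim_glue; first by rewrite sharp_id; exact: subxx.
by apply/funext => q /=; rewrite /push_weight (big_pred1 q)// => q1; rewrite sharp_id.
Qed.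

Section Comp.
Variables (M N L : OA_obj r n) (tau : OA_mor M N) (sigma : OA_mor N L).
Let g (p : flats M) : flats L := sharp sigma (sharp (N := mat N) tau p).
Let g_mono (p q : flats M) (h : fle p q) : fle (g p) (g q) :=
  sharp_mono (mat L) sigma (sharp_mono (mat N) tau h).
Let g_lab (p : flats M) : lab M p \subset lab L (g p) :=
  fintype.subset_trans (mor_adm tau p) (mor_adm sigma _).

Let comp_prism := prism (R := R) (X := X)
  (fun (p q : flats M) (h : fle p q) => sharp_mono (mat L) (OA_comp sigma tau) h) g_mono
  (sharp_comp sigma tau) g_lab.

Lemma comp_prism1 z : comp_prism (1, z) = star R X sigma (star R X tau z).
Proof.
elim/hocolim_ind: z => p w d; rewrite /comp_prism prismE !starE /=.
rewrite (join_inclD _ _ (g_lab p)); congr (to_hocolim (pre_point _ _)).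
apply/val_inj/funext => q' /=; rewrite /prism_weight /push_weight big1 ?add0r; last first.
  by move=> q _; rewrite (moved1 (valP w)) subrr.
rewrite (eq_bigr (val w)); last by move=> q _; exact: (moved1 (valP w)).
(* The fibre over [q'] is split according to the intermediate flat of [N]. *)
rewrite [LHS](partition_big (sharp tau) (fun q1 : flats N => sharp sigma q1 == q'))//=.
apply: eq_bigr => q1 /eqP q1q'; apply: eq_bigl => q /=.
by rewrite andb_idl// => /eqP tq; rewrite /g tq q1q'.
Qed.

(** Taking the closure in [N] before applying [sigma] may enlarge the resulting flat, so [sharp]
    respects composition only up to the inequality [sharp_comp]. That inequality is what the prism
    needs. *)
Lemma star_comp_Ghomotopic (G : Type) (act : G -> X -> X) :
  Ghomotopic R (hocolim_act act) (hocolim_act act)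
    (star R X (OA_comp sigma tau)) (star R X sigma \o star R X tau).
Proof.
apply: (@Ghomotopic_of_continuous _ _ _ _ _ _ _ _ comp_prism).
- exact: prism_continuous.
- exact: prism_at0.
- exact: comp_prism1.
- by move=> s _; exact: prism_equivariant.
Qed.

(** The same prism does not leave [TX]: its time-0 end is [h], which lies in [TX], and [prism_TX]
    propagates this to all times. *)
Lemma restriction_comp_Ghomotopic (G : Type) (act : G -> X -> X)
    (f : TX R X M -> TX R X N) (k : TX R X N -> TX R X L)
    (h : TX R X M -> TX R X L) :
  TX_restriction tau f -> TX_restriction sigma k ->
  TX_restriction (OA_comp sigma tau) h ->
  Ghomotopic R (T_act act) (T_act act) h (k \o f).
Proof.
move=> hf hk hh.
have HT (x : R * TX R X M) : comp_prism (x.1, val x.2) \in TX R X L.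
  apply/mem_set/prism_TX; rewrite prism_at0 -(hh x.2); exact/set_mem/valP.
pose H (x : R * TX R X M) : TX R X L := exist _ (comp_prism (x.1, val x.2)) (HT x).
apply: (@Ghomotopic_of_continuous _ _ _ _ _ _ _ _ H).
- move=> x; apply: continuous_set_type => /=.
  apply: (continuous_compT (@prism_continuous _ _ _ _ _ _ _ _ _ _ _ _)
    (f := fun x : R * TX R X M => (x.1, val x.2))).
  apply: continuous_pair; first exact: cvg_fst.
  apply: (continuous_compT (@set_val_continuous _ (TX R X M)) (f := snd)).
  exact: cvg_snd.
- by move=> z; apply/val_inj => /=; rewrite /comp_prism prism_at0 -hh.
- by move=> z; apply/val_inj => /=; rewrite comp_prism1 -[val z]/(TX_incl z) -hf -hk.
- by move=> s _ b z; apply/val_inj; exact: prism_equivariant.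
Qed.

End Comp.

Section Collapse.

Lemma delta_order_complex M (p : flats M) :
  (fun q : flats M => (q == p)%:R : R) \in order_complex_le R p.
Proof.
have dp (q : flats M) : (q == p)%:R != 0 :> R -> q = p.
  by case: (q =P p) => // _; rewrite eqxx.
apply/mem_set; split=> [q||q /dp ->|q q' /dp -> /dp ->]; rewrite /fle ?subxx//.
by rewrite (bigD1 p)//= eqxx big1 ?addr0// => q qp; rewrite (negbTE qp).
Qed.

Definition delta M (p : flats M) : order_complex_le R p :=
  exist _ (fun q : flats M => (q == p)%:R : R) (delta_order_complex p).

Definition flat_point M (p : flats M) (d : join R X (lab M p)) : hocolim R X M :=
  to_hocolim (pre_point (delta p) d).

Lemma flat_point_continuous M (p : flats M) : continuous (@flat_point M p).
Proof.
move=> d; apply: (continuous_compT (@to_hocolim_continuous R X r n M)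
  (f := fun d => existT (pre_summand R X (M := M)) p (delta p, d))).
apply: (continuous_compT (@existT_continuous _ _ p) (f := fun d => (delta p, d))).
by apply: continuous_pair; [exact: cst_continuous|exact: cvg_id].
Qed.

Lemma flat_point_act M (p : flats M) (G : Type) (act : G -> X -> X) g d :
  hocolim_act act g (flat_point (p := p) d) = flat_point (join_act act g d).
Proof. by rewrite hocolim_actE. Qed.

Lemma hjoin_flat_point M (p : flats M) d :
  hjoin (flat_point (p := p) d) = join_incl (finset.subsetT _) d.
Proof. exact: hjoinE. Qed.

Lemma flat_point_TX M (p : flats M) d :
  flat_rk p != 0%N -> TX R X M (flat_point (p := p) d).
Proof.
move=> /atom_below[a aa ap]; apply/TXP; exists a => // q /=.
by case: (q =P p) => [->//|_]; rewrite eqxx.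
Qed.

(** The bottom flat has rank 0, so its label has all [r] elements. *)
Lemma lab_bot M : [set: 'I_r]%SET \subset lab M (bot_flat (mat M)).
Proof.
by rewrite finset.subTset eqEcard finset.subsetT cardsT card_ord imm_card bot_flat_rk subn0 leqnn.
Qed.

Definition bot_point M (e : join R X [set: 'I_r]%SET) : hocolim R X M :=
  flat_point (join_incl (lab_bot M) e).

Lemma bot_point_continuous M : continuous (@bot_point M).
Proof.
move=> e; apply: (continuous_compT (@flat_point_continuous M _)
  (f := fun e => join_incl (lab_bot M) e)).
exact: join_incl_continuous.
Qed.

Lemma bot_point_equivariant M (G : Type) (act : G -> X -> X) :
  equivariant (join_act act (sigma := [set: 'I_r]%SET)) (hocolim_act act) (@bot_point M).
Proof. by move=> g e; rewrite /bot_point flat_point_act join_act_incl. Qed.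

Lemma star_collapse M N (tau : OA_mor M N) (G : Type) (act : G -> X -> X) :
  Ghomotopic R (hocolim_act act) (hocolim_act act)
    (fun z => bot_point N (hjoin z)) (star R X tau).
Proof.
have bm (p q : flats M) : fle p q -> fle (bot_flat (mat N)) (bot_flat (mat N)).
  by move=> _; exact: subxx.
apply: (@Ghomotopic_of_continuous _ _ _ _ _ _ _ _ (prism bm
  (fun (p q : flats M) (h : fle p q) => sharp_mono (mat N) tau h)
  (fun p => bot_fle (sharp (N := mat N) tau p)) (mor_adm tau))).
- exact: prism_continuous.
- elim/hocolim_ind => p w d; rewrite prismE /= hjoinE /bot_point.
  rewrite (join_inclD _ _ (fintype.subset_trans (mor_adm tau p)
    (imm_anti (lab N) (bot_fle (sharp (N := mat N) tau p))))).
  rewrite -(join_inclD (mor_adm tau p)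
    (imm_anti (lab N) (bot_fle (sharp (N := mat N) tau p)))).
  apply: hocolim_glue; first exact: bot_fle.
  apply/funext => q' /=; rewrite /prism_weight [X in _ + X]big1 ?addr0; last first.
    by move=> q _; exact: (moved0 (valP w)).
  (* A constant map has a single nonempty fibre, which carries the total mass 1. *)
  rewrite eq_sym; case: eqVneq => _; last by rewrite big_pred0_eq.
  have [_ <- _ _] := set_mem (valP w).
  by apply: eq_bigr => q _; rewrite (moved0 (valP w)) subr0.
- exact: prism_at1.
- by move=> s _; exact: prism_equivariant.
Qed.

(* Up to homotopy, a map into the homotopy colimit only depends on its join
   component, because the homotopy colimit contracts onto the bottom flat. *)
Lemma Ghomotopic_star_of_hjoin M N (tau : OA_mor M N) (G : Type)
    (act : G -> X -> X) (f : TX R X M -> TX R X N) :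
  continuous f -> equivariant (T_act act) (T_act act) f ->
  Ghomotopic R (T_act act) (join_act act (sigma := [set: 'I_r]%SET))
    (hjoin \o (TX_incl \o f)) (hjoin \o TX_incl) ->
  Ghomotopic R (T_act act) (hocolim_act act)
    (TX_incl \o f) (star R X tau \o TX_incl).
Proof.
move=> cf ef hf.
have cT K : continuous (TX_incl : TX R X K -> _) by exact: set_val_continuous.
apply: (@Ghomotopic_trans _ _ _ _ _ _ _ (bot_point N \o (hjoin \o TX_incl))); last first.
  by apply: Ghomotopic_precomp (star_collapse tau act); [exact: cT|move=> k z].
apply: (@Ghomotopic_trans _ _ _ _ _ _ _ (bot_point N \o (hjoin \o (TX_incl \o f)))).
  (* The collapse for the identity of [N], pulled back along [f]. *)
  have := star_collapse (OA_id N) act; rewrite star_id => /Ghomotopic_sym.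
  apply: Ghomotopic_precomp => [z|k z].
    apply: (continuous_compT (@set_val_continuous _ (TX R X N)) (f := f)); exact: cf.
  by rewrite /= ef.
apply: Ghomotopic_postcomp hf; first exact: bot_point_continuous.
exact: bot_point_equivariant.
Qed.

End Collapse.

Section Gspaces.
Variables (G : groupType) (act : G -> X -> X) (M : OA_obj r n).
Hypothesis hG : is_Gspace act.

Lemma hocolim_act_continuous g : continuous (hocolim_act (R := R) (M := M) act g).
Proof.
apply: (quotient_map_continuous (@to_hocolim_quotient R X r n M)).
apply: sigT_existT_continuous => p.
pose F (y : pre_summand R X p) : pre_summand R X p := (y.1, join_act act g y.2).
rewrite (_ : (fun y => _) = fun y => to_hocolim (existT _ p (F y))); last first.
  by apply/funext => -[w d]; rewrite /= hocolim_actE.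
move=> y; apply: (continuous_compT (@to_hocolim_continuous R X r n M)
   (f := fun x => existT _ p (F x))).
apply: (continuous_compT (@existT_continuous _ _ p) (f := F)).
apply: continuous_pair; first exact: cvg_fst.
apply: (continuous_compT (f := snd) (@join_act_continuous R X r G act _ g _)).
  by case: hG.
exact: cvg_snd.
Qed.

Lemma hocolim_Gspace : is_Gspace (hocolim_act (R := R) (M := M) act).
Proof.
split; last exact: hocolim_act_continuous.
  by elim/hocolim_ind => p w d; rewrite hocolim_actE /= join_act1.
by move=> g h; elim/hocolim_ind => p w d; rewrite !hocolim_actE /= join_actM.
Qed.

Lemma TX_Gspace : is_Gspace (T_act (R := R) (M := M) act).
Proof.
have [a1 aM ac] := hocolim_Gspace; split=> [z|g h z|g z].
- by apply/val_inj; exact: a1.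
- by apply/val_inj; exact: aM.
- apply: continuous_set_type => /=; apply: (continuous_compT (ac g) (f := fun u : TX R X M => val u)).
  exact: set_val_continuous.
Qed.

End Gspaces.

End Stars.

(** * Maps of joins that move weights between slots *)

Section JoinWeight.
Variables (R : realType) (X : topologicalType) (r : nat).
Implicit Types sigma : {set 'I_r}.

Definition jweight sigma (d : join R X sigma) : 'I_r -> R :=
  (val (of_join d)).1.

Lemma jweightE sigma (d : @pre_join R X r sigma) : jweight (to_join d) = (val d).1.
Proof. by apply/funext => k; have /asboolP[h _] := to_joinK d; exact: h. Qed.

Lemma jweight_continuous sigma k : continuous (fun d : join R X sigma => jweight d k).
Proof.
apply: (quotient_map_continuous (@to_join_quotient R X r sigma)) => d.
rewrite (_ : _ \o _ = fun d : @pre_join R X r sigma => (val d).1 k); last first.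
  by apply/funext => e; rewrite /= jweightE.
exact: pre_join_weight_continuous.
Qed.

Lemma jweight_incl sigma sigma' (h : sigma \subset sigma') (d : join R X sigma) :
  jweight (join_incl h d) = jweight d.
Proof. by rewrite -(of_joinK d) join_inclE !jweightE. Qed.

Lemma jweight_act (G : Type) (act : G -> X -> X) g sigma (d : join R X sigma) :
  jweight (join_act act g d) = jweight d.
Proof. by rewrite -(of_joinK d) join_actE !jweightE. Qed.

Lemma jweightP sigma (d : join R X sigma) :
  [/\ forall k, 0 <= jweight d k, \sum_k jweight d k = 1
    & forall k, k \notin sigma -> jweight d k = 0].
Proof. exact: set_mem (valP (of_join d)). Qed.

End JoinWeight.

(* A family of maps of joins that replaces the weights [t] by [W s t] and lets
   the slot [k] carry the coordinate of the slot [c s t k].  The choice [c] may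
   jump where the weight of the slot vanishes. *)
Section Reweigh.
Variables (R : realType) (X : topologicalType) (r : nat).
Variables (sigma sigma' : {set 'I_r}) (O : set (join R X sigma)).
Variables (W : R -> ('I_r -> R) -> 'I_r -> R).
Variables (c : R -> ('I_r -> R) -> 'I_r -> 'I_r).

Hypothesis O_open : open O.
Hypothesis W_simplex : forall s e (x : {ptws 'I_r -> X}), O e ->
  (W s (jweight e), x) \in pre_join sigma'.
Hypothesis c_supp : forall s e k, O e -> W s (jweight e) k != 0 ->
  jweight e (c s (jweight e) k) != 0.
Hypothesis W_continuous : forall s e k, O e ->
  {for (s, e), continuous (fun y : R * join R X sigma => W y.1 (jweight y.2) k)}.
Hypothesis c_locally_constant : forall s e k, O e -> W s (jweight e) k != 0 ->
  \forall y \near (s, e), c y.1 (jweight y.2) k = c s (jweight e) k.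

Definition pre_reweigh (s : R) (e : O) (x : {ptws 'I_r -> X}) : @pre_join R X r sigma' :=
  exist _ (W s (jweight (val e)) : {ptws 'I_r -> R}, x) (W_simplex s x (set_mem (valP e))).

Definition reweigh (y : R * O) : join R X sigma' :=
  to_join (pre_reweigh y.1 y.2 (fun k =>
    (val (of_join (val y.2))).2 (c y.1 (jweight (val y.2)) k))).

(** Where the new weight is nonzero, [c_supp] makes the source slot relevant, and there all
    representatives of [e] have the same coordinate. *)
Lemma reweighE s (e : O) (d : @pre_join R X r sigma) x : val e = to_join d ->
  (forall k, W s (jweight (val e)) k != 0 ->
     x k = (val d).2 (c s (jweight (val e)) k)) ->
  reweigh (s, e) = to_join (pre_reweigh s e x).
Proof.
move=> ed xd; apply/to_joinP/asboolP; split=> // k Wk.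
change ((val (of_join (val e))).2 (c s (jweight (val e)) k) = x k); rewrite xd//.
have : (val (of_join (val e))).1 (c s (jweight (val e)) k) != 0.
  exact: c_supp (set_mem (valP e)) Wk.
move: (c _ _ _) => k'; rewrite ed.
by have /asboolP[_ h] := to_joinK d; exact: h.
Qed.

Lemma reweigh_act (G : Type) (act : G -> X -> X) g s (e e' : O) :
  val e' = join_act act g (val e) ->
  reweigh (s, e') = join_act act g (reweigh (s, e)).
Proof.
move=> ee.
have E : val e' = to_join (pre_act act g (of_join (val e))) by rewrite ee.
rewrite (@reweighE s e' _ (fun k => act g ((val (of_join (val e))).2
  (c s (jweight (val e)) k))) E) => [|k _ /=]; last by rewrite ee jweight_act.
rewrite /reweigh join_actE; apply/to_joinP/asboolP; split=> // k.
by change (W s (jweight (val e')) k = W s (jweight (val e)) k); rewrite ee jweight_act.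
Qed.

(** The choice [c] may jump, but there are only finitely many slot functions [f]. Each [f] that
    agrees with [c] at the given point on the slots of nonzero weight defines a continuous [F f]
    with the same value there. Near the point [c] is constant on those slots, so every nearby value
    of [reweigh] is a value of one of these [F f]. *)
Lemma reweigh_continuous : continuous reweigh.
Proof.
have cq := @to_join_continuous R X r sigma.
have qP (d : @to_join R X r sigma @^-1` O) : to_join (val d) \in O.
  exact/mem_set/set_mem/(valP d).
pose qO (d : @to_join R X r sigma @^-1` O) : O := exist _ (to_join (val d)) (qP d).
have cqO : continuous qO.
  move=> d; apply: continuous_set_type => /=.
  apply: (continuous_compT cq (f := fun d : @to_join R X r sigma @^-1` O => val d)).
  exact: set_val_continuous.
have qm : quotient_map qO.
  exact: (quotient_map_open cq O_open _ (@to_join_quotient R X r sigma)).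
have qR := @quotient_map_prod R _ _ _ cqO qm.
refine (quotient_map_continuous qR _).
move=> [s0 d0] V /= nV; set y0 := (s0, d0).
pose V' := V°; have V'V : V' `<=` V by exact: interior_subset.
have oV' : open V' by exact: open_interior.
have V'y : V' (reweigh (s0, qO d0)) by exact: nV.
pose pt (d : @to_join R X r sigma @^-1` O) : {ptws 'I_r -> X} := (val (val d)).2.
pose F (f : {ffun 'I_r -> 'I_r}) (y : R * (@to_join R X r sigma @^-1` O)) :=
  pre_reweigh y.1 (qO y.2) (fun k => pt y.2 (f k)).
have RE y (f : {ffun 'I_r -> 'I_r}) :
    (forall k, W y.1 (jweight (val (qO y.2))) k != 0 ->
      f k = c y.1 (jweight (val (qO y.2))) k) ->
    reweigh (y.1, qO y.2) = to_join (F f y).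
  by move=> hf; apply: (@reweighE _ _ (val y.2)) => // k /hf ->.
have cW k : {for y0, continuous (fun y => W y.1 (jweight (val (qO y.2))) k)}.
  apply: (@continuous_comp _ _ _ (fun y : R * (@to_join R X r sigma @^-1` O) =>
    (y.1, val (qO y.2))) (fun y : R * join R X sigma => W y.1 (jweight y.2) k)); last first.
    by apply: W_continuous; exact/set_mem/valP.
  apply: continuous_pair; first exact: cvg_fst.
  apply: (continuous_compT (@set_val_continuous _ O) (f := fun y => qO y.2)).
  by apply: (continuous_compT cqO (f := snd)); exact: cvg_snd.
have cF f : {for y0, continuous (F f)}.
  apply: continuous_set_type => /=; apply: continuous_pair.
    by apply: ptws_continuous => k; exact: cW.
  apply: ptws_continuous => k.
  apply: (continuous_compT (@pre_join_point_continuous R X r sigma (f k))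
    (f := fun y : R * (@to_join R X r sigma @^-1` O) => val y.2)).
  apply: (continuous_compT (@set_val_continuous _ _) (f := snd)).
  exact: cvg_snd.
have near_c : \forall y \near y0, forall k, W s0 (jweight (val (qO d0))) k != 0 ->
    c y.1 (jweight (val (qO y.2))) k = c s0 (jweight (val (qO d0))) k.
  apply: (@filter_forall _ _ (fun k (y : R * (@to_join R X r sigma @^-1` O)) =>
    W s0 (jweight (val (qO d0))) k != 0 ->
    c y.1 (jweight (val (qO y.2))) k = c s0 (jweight (val (qO d0))) k) (nbhs y0) (nbhs_filter y0)) => k.
  have [W0|Wk] := eqVneq (W s0 (jweight (val (qO d0))) k) 0; first by apply: nearW.
  have cv : {for y0, continuous (fun y => (y.1, val (qO y.2)))}.
    apply: continuous_pair; first exact: cvg_fst.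
    apply: (continuous_compT (@set_val_continuous _ O) (f := fun y => qO y.2)).
    by apply: (continuous_compT cqO (f := snd)); exact: cvg_snd.
  have nc : nbhs y0 ((fun y => (y.1, val (qO y.2))) @^-1` [set y | c y.1 (jweight y.2) k =
      c s0 (jweight (val (qO d0))) k]).
    exact: (cv _ (c_locally_constant (set_mem (valP (qO d0))) Wk)).
  by apply: (@filterS _ (nbhs y0) (nbhs_filter y0) _ _ _ nc) => y h _; exact: h.
(* One neighbourhood serves all slot functions, as they form a finite type. *)
have near_F : \forall y \near y0, forall f : {ffun 'I_r -> 'I_r},
    (forall k, W s0 (jweight (val (qO d0))) k != 0 ->
      f k = c s0 (jweight (val (qO d0))) k) -> V' (to_join (F f y)).
  apply: (@filter_forall _ _ (fun (f : {ffun 'I_r -> 'I_r})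
    (y : R * (@to_join R X r sigma @^-1` O)) =>
    (forall k, W s0 (jweight (val (qO d0))) k != 0 ->
      f k = c s0 (jweight (val (qO d0))) k) -> V' (to_join (F f y))) (nbhs y0) (nbhs_filter y0)) => f.
  have [hf|nf] := pselect (forall k, W s0 (jweight (val (qO d0))) k != 0 ->
      f k = c s0 (jweight (val (qO d0))) k); last exact: nearW.
  have : {for y0, continuous (fun y => to_join (F f y))}.
    by apply: continuous_compT; [exact: to_join_continuous|exact: cF].
  move=> /(_ V'); rewrite -(RE y0 f hf) => h.
  have : nbhs y0 ((fun y => to_join (F f y)) @^-1` V').
    by apply: h; exact: open_nbhs_nbhs.
  by apply: (@filterS _ (nbhs y0) (nbhs_filter y0)) => y Vy _; exact: Vy.
suff : nbhs y0 [set y | V (reweigh (y.1, qO y.2))] by [].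
apply: (@filterS2 _ (nbhs y0) (nbhs_filter y0) _ _ _ _ near_c near_F) => y hc hF.
apply: V'V => /=.
rewrite (RE y [ffun k => c y.1 (jweight (val (qO y.2))) k]); last first.
  by move=> k _; rewrite ffunE.
by apply: hF => k Wk; rewrite ffunE hc.
Qed.

End Reweigh.

Lemma pre_join_ext (R : realType) (X : topologicalType) (r : nat)
    (sigma : {set 'I_r}) (d e : @pre_join R X r sigma) :
  (val d).1 = (val e).1 ->
  (forall i, (val e).1 i != 0 -> (val d).2 i = (val e).2 i) -> to_join d = to_join e.
Proof. by move=> h k; apply/to_joinP/asboolP; rewrite h. Qed.

(* The mass of the slot [j] is spread over the slots of small weight; for
   [theta = 1] this retracts the complement of the diagonal onto the join over
   the slots other than [j]. *)
Section Spread.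
Variables (R : realType) (X : topologicalType) (r : nat) (j : 'I_r).
Variables (sigma' : {set 'I_r}) (theta : R -> R).
Hypothesis theta_ge0 : forall s, 0 <= theta s.
Hypothesis theta_continuous : continuous theta.
Hypothesis theta_supp : forall s k, k \notin sigma' -> k = j /\ theta s = 1.
Implicit Types (t : 'I_r -> R) (k : 'I_r).

Definition off_diagonal : set (join R X [set: 'I_r]%SET) :=
  [set e | exists kk : 'I_r * 'I_r, jweight e kk.1 != jweight e kk.2].

(** At [theta s = 1] the slot [j] is emptied and the others get weights proportional to
    [|t k - t j|]: heavier slots keep their point, lighter ones take that of [j]. The switch occurs
    exactly where the weight is zero and the point irrelevant. *)
Definition gap s t k : R := t k - theta s * t j.
Definition spread_weight s t k : R := `|gap s t k| / \sum_i `|gap s t i|.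
Definition spread_slot s t k : 'I_r := if 0 < gap s t k then k else j.

Lemma off_diagonal_open : open off_diagonal.
Proof.
rewrite (_ : off_diagonal = \bigcup_(kk : 'I_r * 'I_r)
    [set e | jweight e kk.1 - jweight e kk.2 != 0]).
  apply: bigcup_open => kk _; apply: (@open_comp _ _
    (fun e : join R X [set: 'I_r]%SET => jweight e kk.1 - jweight e kk.2)
    [set x | x != 0]); last exact: open_neq.
  by move=> e _; apply: continuous_subr; exact: jweight_continuous.
apply/seteqP; split=> [e [kk h]|e [kk _ h]]; exists kk => //=; move: h; by rewrite /= subr_eq0.
Qed.

(** If every gap vanished, all weights would equal [theta s * t j], placing the point on the
    diagonal. *)
Lemma gap_sum_neq0 s e : off_diagonal e -> \sum_i `|gap s (jweight e) i| != 0.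
Proof.
move=> [[k k'] /= /eqP kk]; apply/negP => /eqP h; apply: kk.
have g0 i : jweight e i = theta s * jweight e j.
  apply/eqP; rewrite -subr_eq0 -normr_eq0; apply/eqP.
  have /psumr_eq0P := h; apply => // i' _; exact: normr_ge0.
by rewrite g0 [RHS]g0.
Qed.

Lemma spread_simplex s e (x : {ptws 'I_r -> X}) : off_diagonal e ->
  (spread_weight s (jweight e), x) \in pre_join sigma'.
Proof.
move=> Oe; apply/mem_set; split=> /=.
- by move=> i; rewrite divr_ge0// sumr_ge0.
- by rewrite -mulr_suml divff// gap_sum_neq0.
- move=> i /(theta_supp s)[-> t1].
  by rewrite /spread_weight /gap t1 mul1r subrr normr0 mul0r.
Qed.

Lemma spread_gap s t k : spread_weight s t k != 0 -> gap s t k != 0.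
Proof. by apply: contra_neq => h; rewrite /spread_weight h normr0 mul0r. Qed.

(** A positive gap forces [t k > 0]; a negative one forces [t j > 0], because [t k] is
    nonnegative. *)
Lemma spread_slot_supp s e k : off_diagonal e ->
  spread_weight s (jweight e) k != 0 ->
  jweight e (spread_slot s (jweight e) k) != 0.
Proof.
have [t0 _ _] := jweightP e.
move=> _ /spread_gap g0; rewrite /spread_slot; case: ltP => g.
  by apply: lt0r_neq0; rewrite (le_lt_trans _ (_ : theta s * jweight e j < _)) ?mulr_ge0// -subr_gt0.
apply: contra_neq g0 => tj; apply/le_anti; rewrite g /= /gap tj mulr0 subr0.
exact: t0.
Qed.

Lemma gap_continuous k :
  continuous (fun y : R * join R X [set: 'I_r]%SET => gap y.1 (jweight y.2) k).
Proof.
have cj i : continuous (fun y : R * join R X [set: 'I_r]%SET => jweight y.2 i).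
  move=> y; apply: (continuous_compT (@jweight_continuous R X r _ i) (f := snd)).
  exact: cvg_snd.
move=> y; apply: (@continuous_subr _ _ (fun y : R * join R X [set: 'I_r]%SET =>
  jweight y.2 k) (fun y => theta y.1 * jweight y.2 j)); first exact: cj.
apply: (@continuous_mulr _ _ (fun y : R * join R X [set: 'I_r]%SET => theta y.1));
  last exact: cj.
by apply: (continuous_compT theta_continuous (f := fst)); exact: cvg_fst.
Qed.

Lemma spread_weight_continuous s e k : off_diagonal e ->
  {for (s, e), continuous (fun y : R * join R X [set: 'I_r]%SET =>
     spread_weight y.1 (jweight y.2) k)}.
Proof.
move=> Oe.
have cn i : continuous (fun y : R * join R X [set: 'I_r]%SET => `|gap y.1 (jweight y.2) i|).
  by move=> y; exact: (continuous_normr (@gap_continuous i y)).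
apply: (continuous_mulr (cn k _)).
apply: (@continuous_invr _ _ (fun y : R * join R X [set: 'I_r]%SET =>
  \sum_i `|gap y.1 (jweight y.2) i|)); first exact: gap_sum_neq0.
by apply: (continuous_big (@add_continuous R)) => i _; exact: cn.
Qed.

(** The slot depends only on the sign of the gap, and a nonzero gap keeps its sign nearby. *)
Lemma spread_slot_locally_constant s e k : off_diagonal e ->
  spread_weight s (jweight e) k != 0 ->
  \forall y \near (s, e), spread_slot y.1 (jweight y.2) k =
                          spread_slot s (jweight e) k.
Proof.
move=> _ /spread_gap; rewrite neq_lt => /orP[] g.
  have n : nbhs (s, e) [set y | gap y.1 (jweight y.2) k < 0].
    exact: (cvgr_lt _ (@gap_continuous k (s, e)) _ g).
  suff : nbhs (s, e) [set y | spread_slot y.1 (jweight y.2) k =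
                              spread_slot s (jweight e) k] by [].
  by apply: filterS n => y /ltW gy; rewrite /spread_slot /= !ltNge gy (ltW g).
have n : nbhs (s, e) [set y | 0 < gap y.1 (jweight y.2) k].
  exact: (cvgr_gt _ (@gap_continuous k (s, e)) _ g).
suff : nbhs (s, e) [set y | spread_slot y.1 (jweight y.2) k =
                            spread_slot s (jweight e) k] by [].
by apply: filterS n => y gy; rewrite /spread_slot /= g gy.
Qed.

(** Used twice: as a homotopy in the full join, with [theta] the clamped time, and as a retraction
    onto the join without slot [j], with [theta] constantly 1. The condition [theta_supp] is phrased
    to cover both. *)
Definition spread : R * off_diagonal -> join R X sigma' :=
  reweigh spread_slot spread_simplex.

Lemma spread_continuous : continuous spread.
Proof.
apply: reweigh_continuous.
- exact: off_diagonal_open.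
- exact: spread_slot_supp.
- exact: spread_weight_continuous.
- exact: spread_slot_locally_constant.
Qed.

Lemma spread_act (G : Type) (act : G -> X -> X) g s (e e' : off_diagonal) :
  val e' = join_act act g (val e) ->
  spread (s, e') = join_act act g (spread (s, e)).
Proof. by apply: reweigh_act; exact: spread_slot_supp. Qed.

(** The product vanishes for two reasons: [theta] is 0 at the start of the homotopy, and [t j] is 0
    on the join over the other slots, which the retraction therefore fixes. *)
Lemma spread_id s (e : off_diagonal) (d : join R X sigma')
    (h : sigma' \subset [set: 'I_r]%SET) :
  val e = join_incl h d -> theta s * jweight d j = 0 -> spread (s, e) = d.
Proof.
move=> ed tj; rewrite -[RHS]of_joinK.
have ed' : val e = to_join (pre_incl h (of_join d)) by rewrite ed.
have [t0 t1 _] := jweightP d.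
have gE k : gap s (jweight d) k = jweight d k by rewrite /gap tj subr0.
have WE : spread_weight s (jweight (val e)) = jweight d.
  rewrite ed jweight_incl; apply/funext => k.
  rewrite /spread_weight; under eq_bigr do rewrite gE ger0_norm//.
  by rewrite t1 divr1 gE ger0_norm.
rewrite /spread (@reweighE _ _ _ _ _ _ _ _ _ spread_slot_supp s e _ (val (of_join d)).2 ed').
  exact: pre_join_ext.
move=> k; rewrite WE => dk /=; congr ((val (of_join d)).2 _).
by rewrite /spread_slot ed jweight_incl gE lt_neqAle eq_sym dk t0.
Qed.

End Spread.


Section SpreadTo.
Variables (R : realType) (X : topologicalType) (r : nat) (j : 'I_r).

Lemma clamp_supp (s : R) (k : 'I_r) : k \notin [set: 'I_r]%SET -> k = j /\ clamp s = 1.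
Proof. by rewrite inE. Qed.

Lemma const_supp (s : R) (k : 'I_r) :
  k \notin (~: [set j])%SET -> k = j /\ (fun=> 1) s = 1 :> R.
Proof. by rewrite !inE negbK => /eqP ->. Qed.

Definition spread_homotopy : R * @off_diagonal R X r -> join R X [set: 'I_r]%SET :=
  spread (theta := @clamp R) clamp_supp.

Definition retract_off (e : @off_diagonal R X r) : join R X (~: [set j])%SET :=
  spread (theta := fun=> 1) const_supp (0, e).

Lemma spread_homotopy_continuous : continuous spread_homotopy.
Proof.
apply: spread_continuous; last exact: clamp_continuous.
by move=> s; case/andP: (clamp_itv s).
Qed.

Lemma retract_off_continuous : continuous retract_off.
Proof.
have c : continuous (spread (X := X) (theta := fun=> 1) const_supp).
  apply: spread_continuous; first by move=> _; exact: ler01.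
  exact: cst_continuous.
move=> e; apply: (continuous_compT c (f := fun e : @off_diagonal R X r => (0 : R, e))).
by apply: continuous_pair; [exact: cst_continuous|exact: cvg_id].
Qed.

Lemma spread_homotopy0 e : spread_homotopy (0, e) = val e.
Proof.
apply: (@spread_id _ _ _ _ _ _ _ _ _ _ _ (finset.subsetT _)).
- by move=> s; case/andP: (clamp_itv s).
- rewrite -[X in join_incl _ X]of_joinK join_inclE -[LHS]of_joinK.
  exact: pre_join_ext.
- by rewrite clamp0 mul0r.
Qed.

Lemma spread_homotopy1 e :
  spread_homotopy (1, e) = join_incl (finset.subsetT _) (retract_off e).
Proof.
rewrite /retract_off /spread /reweigh join_inclE; apply: pre_join_ext => /=.
  by apply/funext => k; rewrite /spread_weight /gap clamp1.
by move=> k _; rewrite /spread_slot /gap clamp1.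
Qed.

Lemma retract_off_id e d (h : (~: [set j] \subset [set: 'I_r])%SET) :
  val e = join_incl h d -> retract_off e = d.
Proof.
have h0 (s : R) : 0 <= (fun=> 1) s :> R by exact: ler01.
move=> ed; apply: (@spread_id _ _ _ _ _ _ h0 _ _ _ _ _ ed).
by have [_ _ d0] := jweightP d; rewrite d0 ?mulr0// !inE eqxx.
Qed.

Lemma spread_homotopy_act (G : Type) (act : G -> X -> X) g s e e' :
  val e' = join_act act g (val e) ->
  spread_homotopy (s, e') = join_act act g (spread_homotopy (s, e)).
Proof. by apply: spread_act => u; case/andP: (clamp_itv u). Qed.

Lemma retract_off_act (G : Type) (act : G -> X -> X) g e e' :
  val e' = join_act act g (val e) ->
  retract_off e' = join_act act g (retract_off e).
Proof. by apply: spread_act => u; exact: ler01. Qed.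

End SpreadTo.

(* The slot [b] is renamed to the empty slot [a] by letting its mass flow. *)
Section Rename.
Variables (R : realType) (X : topologicalType) (r : nat) (a b : 'I_r).
Variables (sigma' : {set 'I_r}) (theta : R -> R).
Hypothesis theta_itv : forall s, 0 <= theta s <= 1.
Hypothesis theta_continuous : continuous theta.
Hypothesis theta_supp : forall s k, k \notin sigma' -> k = b /\ theta s = 1.
Implicit Types (t : 'I_r -> R) (k : 'I_r).

(** The slots [a] and [b] may coincide: the slot [a] is empty, so both prescriptions then give
    weight 0. *)
Definition rename_weight s t k : R :=
  if k == a then theta s * t b else if k == b then (1 - theta s) * t b else t k.
Definition rename_slot (s : R) t k : 'I_r := if k == a then b else k.

Lemma rename_simplex s (e : join R X (~: [set a])%SET) (x : {ptws 'I_r -> X}) :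
  [set: join R X (~: [set a])%SET] e ->
  (rename_weight s (jweight e), x) \in pre_join sigma'.
Proof.
move=> _; have [t0 t1 ta] := jweightP e; have /andP[h0 h1] := theta_itv s.
have {}ta : jweight e a = 0 by apply: ta; rewrite !inE eqxx.
apply/mem_set; split=> /=.
- move=> k; rewrite /rename_weight; case: ifP => _; first exact: mulr_ge0.
  by case: ifP => _ //; apply: mulr_ge0 => //; rewrite subr_ge0.
- rewrite -t1 (bigD1 a)//= [RHS](bigD1 a)//= ta add0r /rename_weight eqxx.
  have [ab|ab] := eqVneq b a.
    rewrite ab ta mulr0 add0r; apply: eq_bigr => k ka; by rewrite (negbTE ka).
  rewrite (bigD1 b)//= [RHS](bigD1 b)//= (negbTE ab) eqxx addrA -mulrDl.
  rewrite [theta s + _]addrC subrK mul1r; congr (_ + _).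
  by apply: eq_bigr => k /andP[ka kb]; rewrite (negbTE ka) (negbTE kb).
- move=> k /(theta_supp s)[-> th1]; rewrite /rename_weight th1 subrr mul0r eqxx.
  by case: eqVneq => // ->; rewrite mul1r.
Qed.

Lemma rename_slot_supp s (e : join R X (~: [set a])%SET) k :
  [set: join R X (~: [set a])%SET] e ->
  rename_weight s (jweight e) k != 0 ->
  jweight e (rename_slot s (jweight e) k) != 0.
Proof.
move=> _; rewrite /rename_weight /rename_slot; case: ifP => _.
  by rewrite mulf_eq0 negb_or => /andP[].
by case: (k =P b) => [->|//]; rewrite mulf_eq0 negb_or => /andP[].
Qed.

Lemma rename_weight_continuous s (e : join R X (~: [set a])%SET) k :
  [set: join R X (~: [set a])%SET] e ->
  {for (s, e), continuous (fun y : R * join R X (~: [set a])%SET =>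
     rename_weight y.1 (jweight y.2) k)}.
Proof.
move=> _.
have cj i : continuous (fun y : R * join R X (~: [set a])%SET => jweight y.2 i).
  move=> y; apply: (continuous_compT (@jweight_continuous R X r _ i) (f := snd)).
  exact: cvg_snd.
have ct : continuous (fun y : R * join R X (~: [set a])%SET => theta y.1).
  by move=> y; apply: (continuous_compT theta_continuous (f := fst)); exact: cvg_fst.
rewrite /rename_weight; case: (k == a).
  exact: (continuous_mulr (ct _) (cj b _)).
case: (k == b); last exact: cj.
apply: (@continuous_mulr _ _ (fun y : R * join R X (~: [set a])%SET => 1 - theta y.1)
  _ _ _ (cj b _)).
by apply: (@continuous_subr _ _ (fun=> 1)); [exact: cst_continuous|exact: ct].
Qed.

Definition rename (y : R * join R X (~: [set a])%SET) : join R X sigma' :=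
  reweigh rename_slot rename_simplex (y.1, exist _ y.2 (mem_setT y.2)).

Lemma rename_continuous : continuous rename.
Proof.
have c : continuous (reweigh rename_slot rename_simplex).
  apply: reweigh_continuous.
  - exact: openT.
  - exact: rename_slot_supp.
  - exact: rename_weight_continuous.
  - move=> s e k _ _.
    suff : nbhs (s, e) [set y | rename_slot y.1 (jweight y.2) k =
                                rename_slot s (jweight e) k] by [].
    by apply: filterS (@filterT _ (nbhs (s, e)) _).
move=> y; apply: (continuous_compT c (f := fun y : R * join R X (~: [set a])%SET =>
  (y.1, exist _ y.2 (mem_setT y.2) : [set: join R X (~: [set a])%SET]))).
apply: continuous_pair; first exact: cvg_fst.
by apply: continuous_set_type; exact: cvg_snd.
Qed.

Lemma rename_act (G : Type) (act : G -> X -> X) g s e :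
  rename (s, join_act act g e) = join_act act g (rename (s, e)).
Proof. by apply: reweigh_act => //; exact: rename_slot_supp. Qed.

Lemma renameE s (d : @pre_join R X r (~: [set a])%SET) (d' : @pre_join R X r sigma') :
  (val d').1 = rename_weight s (val d).1 ->
  (forall k, (val d').1 k != 0 -> (val d').2 k = (val d).2 (rename_slot s (val d).1 k)) ->
  rename (s, to_join d) = to_join d'.
Proof.
move=> h1 h2; rewrite /rename (@reweighE _ _ _ _ _ _ _ _ _ rename_slot_supp s _ d (val d').2)//=.
  by apply: pre_join_ext => //=; rewrite jweightE h1.
by move=> k; rewrite jweightE -h1; exact: h2.
Qed.

End Rename.

Section RenameTo.
Variables (R : realType) (X : topologicalType) (r : nat).
Implicit Types a b : 'I_r.

Lemma one_itv (s : R) : 0 <= (fun=> 1 : R) s <= 1.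
Proof. by rewrite ler01 lexx. Qed.

Definition rename_homotopy a b : R * join R X (~: [set a])%SET -> join R X [set: 'I_r]%SET :=
  rename (@clamp_itv R) (@clamp_supp R r b) (a := a).

Definition rename_to a b (e : join R X (~: [set a])%SET) : join R X (~: [set b])%SET :=
  rename (theta := fun=> 1) one_itv (@const_supp R r b) (a := a) (0, e).

Lemma rename_homotopy_continuous a b : continuous (@rename_homotopy a b).
Proof. by apply: rename_continuous; exact: clamp_continuous. Qed.

Lemma rename_to_continuous a b : continuous (@rename_to a b).
Proof.
have c : continuous (rename (X := X) (theta := fun=> 1) one_itv (@const_supp R r b) (a := a)).
  by apply: rename_continuous; exact: cst_continuous.
move=> e; apply: (continuous_compT c (f := fun e => (0 : R, e))).
by apply: continuous_pair; [exact: cst_continuous|exact: cvg_id].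
Qed.

Lemma rename_homotopy0 a b e :
  @rename_homotopy a b (0, e) = join_incl (finset.subsetT _) e.
Proof.
have [_ _ ta] := set_mem (valP (of_join e)).
rewrite -(of_joinK e) join_inclE; apply: renameE => [|k /=].
  apply/funext => k; rewrite /rename_weight clamp0 mul0r subr0 mul1r /=.
  case: (k =P a) => [->|_]; first by rewrite ta// !inE eqxx.
  by case: (k =P b) => [->|].
rewrite /rename_slot; case: (k =P a) => [->|//].
by rewrite ta ?eqxx// !inE eqxx.
Qed.

Lemma rename_homotopy1 a b e :
  @rename_homotopy a b (1, e) = join_incl (finset.subsetT _) (rename_to b e).
Proof.
rewrite /rename_to /rename /reweigh join_inclE; apply: pre_join_ext => //=.
by apply/funext => k; rewrite /rename_weight clamp1.
Qed.

(** A strict equality, as the strict splitting [section_ofK] requires. *)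
Lemma rename_toK a b e : rename_to a (@rename_to a b e) = e.
Proof.
have [_ _ ta] := set_mem (valP (of_join e)).
have {}ta : (val (of_join e)).1 a = 0 by apply: ta; rewrite !inE eqxx.
rewrite -[RHS]of_joinK.
apply: renameE => [|k] /=.
  apply/funext => k; rewrite /jweight /rename_weight eqxx subrr !mul0r !mul1r.
  case: (k =P b) => [->//|_].
  by case: (k =P a) => [->|//]; rewrite ta; case: (a =P b).
move=> tk; rewrite /rename_slot; case: (k =P b) => [->|_].
  by rewrite eqxx.
by case: (k =P a) => // ka; move: tk; rewrite ka ta eqxx.
Qed.

Lemma rename_homotopy_act a b (G : Type) (act : G -> X -> X) g s e :
  @rename_homotopy a b (s, join_act act g e) =
  join_act act g (rename_homotopy b (s, e)).
Proof. exact: rename_act. Qed.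

Lemma rename_to_act a b (G : Type) (act : G -> X -> X) g e :
  @rename_to a b (join_act act g e) = join_act act g (rename_to b e).
Proof. exact: rename_act. Qed.

End RenameTo.

(** * Isomorphisms of immersed matroids *)

Section IsoMorphisms.
Variables (r n : nat).
Implicit Types (M N L : OA_obj r n).

Lemma OA_mor_eq M N (f g : OA_mor M N) : (f : _ -> _) =1 g -> f = g.
Proof.
case: f g => [f fw fa] [g gw ga] /= /funext fg; subst g.
by rewrite (Prop_irrelevance fw gw) (Prop_irrelevance fa ga).
Qed.

Definition OA_inverse M N (f : OA_mor M N) (g : OA_mor N M) : Prop :=
  cancel f g /\ cancel g f.

Definition OA_iso M N (f : OA_mor M N) : Prop := exists g, OA_inverse f g.

Definition OA_isomorphic M N : Prop := exists f : OA_mor M N, OA_iso f.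

Lemma OA_iso_id M : OA_iso (OA_id M).
Proof. by exists (OA_id M). Qed.

Lemma OA_iso_comp M N L (tau : OA_mor M N) (sigma : OA_mor N L) :
  OA_iso tau -> OA_iso sigma -> OA_iso (OA_comp sigma tau).
Proof.
move=> [tau' [t1 t2]] [sigma' [s1 s2]]; exists (OA_comp tau' sigma').
by split=> x /=; rewrite (s1, t2) (t1, s2).
Qed.

Lemma OA_isomorphic_sym M N : OA_isomorphic M N -> OA_isomorphic N M.
Proof. by move=> [f [g [fK gK]]]; exists g, f. Qed.

Lemma OA_isomorphic_trans M N L :
  OA_isomorphic M N -> OA_isomorphic N L -> OA_isomorphic M L.
Proof. by move=> [f hf] [g hg]; exists (OA_comp g f); exact: OA_iso_comp. Qed.

Lemma option_can_sym M N (f : option (ground M) -> option (ground N)) g :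
  cancel f g -> cancel g f.
Proof.
move=> fK; apply/bij_can_sym => //; apply: inj_card_bij (can_inj fK) _.
by rewrite !card_option !ground_card.
Qed.

(* The ground sets have the same finite cardinality, so one-sided inverses of
   morphisms are two-sided and the non-isomorphisms form a two-sided ideal. *)
Lemma OA_iso_factors M N L (tau : OA_mor M N) (sigma : OA_mor N L) :
  OA_iso (OA_comp sigma tau) -> OA_iso tau /\ OA_iso sigma.
Proof.
move=> [rho [h1 h2]]; split.
  by exists (OA_comp rho sigma); split=> //; exact: option_can_sym.
by exists (OA_comp tau rho); split=> //; exact: option_can_sym.
Qed.

(** The weak map [g] carries the image of [p] back to [p] without raising the rank, so that image
    has positive rank if [p] does. *)
Lemma cancel_keeps_rank M N (f : OA_mor M N) (g : OA_mor N M) :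
  cancel f g -> keeps_positive_rank f.
Proof.
move=> fK p; apply: contra_neq; rewrite /flat_rk /= rk_cl => h.
have [g0 gw] := mor_weak g.
apply/eqP; rewrite -leqn0 -h -[X in (rk _ X <= _)%N]image_off_id.
have -> : id = g \o f :> (option (ground M) -> _) by apply/funext => x /=; rewrite fK.
by rewrite image_off_comp.
Qed.

Definition class_rep M : OA_obj r n :=
  sval (cid (ex_intro (OA_isomorphic M) M (ex_intro _ _ (OA_iso_id M)))).

Lemma class_rep_iso M : OA_isomorphic M (class_rep M).
Proof. exact: (svalP (cid _)). Qed.

(** Isomorphic objects define the same predicate of being isomorphic to them, and the choice depends
    on that predicate alone. Hence the representatives are equal, not merely isomorphic. *)
Lemma class_rep_eq M N : OA_isomorphic M N -> class_rep M = class_rep N.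
Proof.
have H (K K' : OA_obj r n -> Prop) (h : exists P, K P) (h' : exists P, K' P) :
    K = K' -> sval (cid h) = sval (cid h').
  by move=> KK; subst K'; rewrite (Prop_irrelevance h h').
move=> MN; apply: H; apply/funext => P; apply/propext.
by split; apply: OA_isomorphic_trans => //; exact: OA_isomorphic_sym.
Qed.

End IsoMorphisms.

(** * Restrictions to [TX] and their join coordinates *)

Section StarRestriction.
Variables (R : realType) (X : topologicalType) (r n : nat).

Definition TX_star (M N : OA_obj r n) (tau : OA_mor M N)
    (h : keeps_positive_rank tau) (z : TX R X M) : TX R X N :=
  exist _ (star R X tau (val z)) (star_TX h (valP z)).

Variables (M N : OA_obj r n) (tau : OA_mor M N) (h : keeps_positive_rank tau).

Lemma TX_star_continuous : continuous (TX_star h).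
Proof.
move=> z; apply: continuous_set_type => /=.
apply: (continuous_compT (@star_continuous R X r n M N tau) (f := fun z : TX R X M => val z)).
exact: set_val_continuous.
Qed.

Lemma TX_star_equivariant (G : Type) (act : G -> X -> X) :
  equivariant (T_act act) (T_act act) (TX_star h).
Proof. by move=> g z; apply/val_inj; exact: star_equivariant. Qed.

Lemma TX_star_restriction : TX_restriction tau (TX_star h).
Proof. by []. Qed.

End StarRestriction.

(** The composite morphism is the identity, whose [star] is the identity, so the comparison of
    restrictions inside [TX] gives the homotopy. *)
Lemma TX_star_cancel (R : realType) (X : topologicalType) (r n : nat)
    (M N : OA_obj r n) (f : OA_mor M N) (g : OA_mor N M)
    (hf : keeps_positive_rank f) (hg : keeps_positive_rank g)
    (G : Type) (act : G -> X -> X) :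
  cancel f g ->
  Ghomotopic R (T_act act) (T_act act) (TX_star (R := R) (X := X) hg \o TX_star hf) idfun.
Proof.
move=> fK; apply: Ghomotopic_sym.
apply: (restriction_comp_Ghomotopic act (TX_star_restriction hf) (TX_star_restriction hg)).
have -> : OA_comp g f = OA_id M by apply: OA_mor_eq.
by move=> z; rewrite star_id.
Qed.

Section OffDiagonal.
Variables (R : realType) (X : topologicalType) (r n : nat) (M : OA_obj r n).

(** The index flat [p] lies above an atom, so its label has fewer than [r] elements and misses a
    slot. The label is also nonempty, as join weights add up to 1; hence [r] exceeds the rank of
    [p], which is at least 1. *)
Lemma TX_slots (z : TX R X M) :
  (exists k, jweight (hjoin (val z)) k = 0) /\ (1 < r)%N.
Proof.
have /set_mem := valP z; elim/hocolim_ind: (val z) => p w d /TXP[a /eqP aa wa].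
have [q wq] := supp_neq0 w; have [_ _ wp _] := set_mem (valP w).
have rp : (0 < flat_rk p)%N.
  by rewrite -aa; apply: rk_mono; exact: fle_trans (wa _ wq) (wp _ wq).
have [d0 d1 dn] := jweightP d; rewrite hjoinE jweight_incl.
have [k kd] : exists k, k \in lab M p.
  apply/not_existsP => h; have : \sum_k jweight d k = 0.
    by rewrite big1// => k _; apply: dn; apply/negP => /h.
  by rewrite d1 => /eqP; rewrite oner_eq0.
have lp := imm_card (lab M) p.
have lp0 : (0 < #|lab M p|)%N by apply/card_gt0P; exists k.
split; last by rewrite lp subn_gt0 in lp0; exact: leq_ltn_trans rp lp0.
have : ~~ ([set: 'I_r]%SET \subset lab M p).
  apply/negP => /subset_leq_card; rewrite cardsT card_ord lp leqNgt.
  by rewrite ltn_subrL rp (leq_trans _ (leq_subr (flat_rk p) r))// -lp.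
by case/subsetPn => k' _ k'd; exists k'; exact: dn.
Qed.

Lemma hjoin_off_diagonal (z : TX R X M) : hjoin (val z) \in @off_diagonal R X r.
Proof.
have [[k k0] _] := TX_slots z; have [_ t1 _] := jweightP (hjoin (val z)).
apply/mem_set; apply: contrapT => h; have : \sum_i jweight (hjoin (val z)) i = 0.
  rewrite big1// => i _; apply/eqP/negPn/negP => ti; apply: h.
  by exists (i, k); rewrite /= k0.
by rewrite t1 => /eqP; rewrite oner_eq0.
Qed.

Definition to_off (z : TX R X M) : @off_diagonal R X r :=
  exist _ (hjoin (val z)) (hjoin_off_diagonal z).

Lemma to_off_continuous : continuous to_off.
Proof.
move=> z; apply: continuous_set_type => /=.
apply: (continuous_compT (@hjoin_continuous R X r n M) (f := fun z : TX R X M => val z)).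
exact: set_val_continuous.
Qed.

Lemma to_off_act (G : Type) (act : G -> X -> X) g z :
  val (to_off (T_act act g z)) = join_act act g (val (to_off z)).
Proof. exact: hjoin_act. Qed.

End OffDiagonal.

(** * Construction of the functor *)

Section Functor.
Variables (R : realType) (X : topologicalType) (r n : nat) (i0 : 'I_r).
Variables (pos_flat : forall M : OA_obj r n, flats M) (slot : OA_obj r n -> 'I_r).
Hypothesis pos_flat_rk : forall M, flat_rk (pos_flat M) != 0%N.
Hypothesis slot_lab : forall M, (~: [set slot M])%SET \subset lab M (pos_flat M).
Implicit Types (M N L P : OA_obj r n).

Local Notation J0 := (join R X (~: [set i0])%SET).
Local Notation J := (join R X [set: 'I_r]%SET).

(** The empty slot [i0] is common to all objects, so that a single join [J0] serves them all; it is
    renamed to the empty slot of [M] before the join is placed at the vertex [pos_flat M]. *)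
Definition section_of M (e : J0) : TX R X M :=
  exist _ (flat_point (join_incl (slot_lab M) (rename_to (slot M) e)))
    (mem_set (flat_point_TX _ (pos_flat_rk M))).

Definition retraction_of M (z : TX R X M) : J0 :=
  rename_to i0 (retract_off (slot M) (to_off z)).

Lemma hjoin_section M e :
  hjoin (val (section_of M e)) = join_incl (finset.subsetT _) (rename_to (slot M) e).
Proof. by rewrite /= hjoin_flat_point; exact: join_inclD. Qed.

(** The section has an empty slot where the retraction spreads mass, so nothing moves and the two
    renamings cancel. *)
Lemma section_ofK M : cancel (section_of M) (@retraction_of M).
Proof.
move=> e; rewrite /retraction_of.
have E : val (to_off (section_of M e)) = _ := hjoin_section M e.
by rewrite (retract_off_id E) rename_toK.
Qed.

Lemma section_of_continuous M : continuous (section_of M).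
Proof.
move=> e; apply: continuous_set_type => /=.
apply: (continuous_compT (@flat_point_continuous R X r n M (pos_flat M))
  (f := fun e => join_incl (slot_lab M) (rename_to (slot M) e))).
apply: (continuous_compT (@join_incl_continuous R X r _ _ (slot_lab M))
  (f := fun e => rename_to (slot M) e)).
exact: rename_to_continuous.
Qed.

Lemma retraction_of_continuous M : continuous (@retraction_of M).
Proof.
move=> z; apply: (continuous_compT (@rename_to_continuous R X r _ i0)
  (f := fun z : TX R X M => retract_off (slot M) (to_off z))).
apply: (continuous_compT (@retract_off_continuous R X r (slot M)) (f := @to_off R X r n M)).
exact: to_off_continuous.
Qed.

Section Equivariance.
Variables (G : Type) (act : G -> X -> X).

Local Notation aJ := (join_act (R := R) act (sigma := [set: 'I_r]%SET)).

Lemma section_of_equivariant M :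
  equivariant (join_act act (sigma := _)) (T_act act) (section_of M).
Proof.
move=> g e; apply/val_inj; rewrite /= flat_point_act.
by rewrite rename_to_act join_act_incl.
Qed.

Lemma retraction_of_equivariant M :
  equivariant (T_act act) (join_act act (sigma := _)) (@retraction_of M).
Proof.
move=> g z; rewrite /retraction_of.
by rewrite (retract_off_act (slot M) (to_off_act act g z)) rename_to_act.
Qed.

Lemma rename_Ghomotopic a b :
  Ghomotopic R (join_act act (sigma := _)) aJ
    (join_incl (finset.subsetT (~: [set a])%SET))
    (join_incl (finset.subsetT _) \o @rename_to R X r a b).
Proof.
apply: (@Ghomotopic_of_continuous _ _ _ _ _ _ _ _ (@rename_homotopy R X r a b)).
- exact: rename_homotopy_continuous.
- exact: rename_homotopy0.
- exact: rename_homotopy1.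
- by move=> s _ g e; exact: rename_homotopy_act.
Qed.

Lemma retract_off_Ghomotopic M :
  Ghomotopic R (T_act act) aJ (hjoin \o @TX_incl R X r n M)
    (join_incl (finset.subsetT _) \o (retract_off (slot M) \o @to_off R X r n M)).
Proof.
apply: (@Ghomotopic_of_continuous _ _ _ _ _ _ _ _
  (fun x : R * TX R X M => spread_homotopy (slot M) (x.1, to_off x.2))).
- move=> x; apply: (continuous_compT (@spread_homotopy_continuous R X r (slot M))
    (f := fun x : R * TX R X M => (x.1, to_off x.2))).
  apply: continuous_pair; first exact: cvg_fst.
  apply: (continuous_compT (@to_off_continuous R X r n M) (f := snd)).
  exact: cvg_snd.
- by move=> z; rewrite spread_homotopy0.
- by move=> z; rewrite spread_homotopy1.
- by move=> s _ g z; apply: spread_homotopy_act; exact: to_off_act.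
Qed.

(** On join coordinates the composite is a spreading followed by two renamings, each homotopic in
    the full join to the inclusion. Thus section after retraction meets the criterion
    [Ghomotopic_star_of_hjoin] for any morphism from [M] to [N]. *)
Lemma section_retraction_Ghomotopic M N :
  Ghomotopic R (T_act act) aJ
    (hjoin \o (TX_incl \o (section_of N \o @retraction_of M))) (hjoin \o TX_incl).
Proof.
have -> : hjoin \o (TX_incl \o (section_of N \o @retraction_of M)) =
    join_incl (finset.subsetT _) \o rename_to (slot N) \o @retraction_of M.
  by apply/funext => z; exact: hjoin_section.
apply: Ghomotopic_sym; apply: Ghomotopic_trans (retract_off_Ghomotopic M) _.
apply: (@Ghomotopic_trans _ _ _ _ _ _ _
    (join_incl (finset.subsetT _) \o @retraction_of M)); last first.
  apply: Ghomotopic_precomp (rename_Ghomotopic i0 (slot N)).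
    exact: retraction_of_continuous.
  exact: retraction_of_equivariant.
apply: (@Ghomotopic_precomp _ _ _ _ _ _ _ _ _ _ (retract_off (slot M) \o @to_off R X r n M)
  _ _ (rename_Ghomotopic (slot M) i0)).
  move=> z; apply: (continuous_compT (@retract_off_continuous R X r (slot M))
    (f := @to_off R X r n M)).
  exact: to_off_continuous.
by move=> g z; apply: retract_off_act; exact: to_off_act.
Qed.

End Equivariance.

Definition iso_mor M P (h : OA_isomorphic M P) : OA_mor M P := sval (cid h).
Definition iso_inv M P (h : OA_isomorphic M P) : OA_mor P M :=
  sval (cid (svalP (cid h))).

Lemma iso_invP M P (h : OA_isomorphic M P) : OA_inverse (iso_mor h) (iso_inv h).
Proof. exact: (svalP (cid (svalP (cid h)))). Qed.

Definition transport_to M P (h : OA_isomorphic M P) : TX R X M -> TX R X P :=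
  TX_star (cancel_keeps_rank (iso_invP h).1).
Definition transport_from M P (h : OA_isomorphic M P) : TX R X P -> TX R X M :=
  TX_star (cancel_keeps_rank (iso_invP h).2).

Lemma OA_iso_class_rep M N (tau : OA_mor M N) :
  OA_iso tau -> OA_isomorphic N (class_rep M).
Proof.
move=> h; rewrite (class_rep_eq (ex_intro _ tau h : OA_isomorphic M N)).
exact: class_rep_iso.
Qed.

(* The induced maps of isomorphisms are made independent of the isomorphism, as
   no choice of maps for the morphisms that annihilate atoms is compatible with
   all automorphisms. *)
Definition T_map M N (tau : OA_mor M N) : TX R X M -> TX R X N :=
  match pselect (OA_iso tau) with
  | left h => transport_from (OA_iso_class_rep h) \o transport_to (class_rep_iso M)
  | right _ => transport_from (class_rep_iso N) \o section_of (class_rep N) \o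
      @retraction_of (class_rep M) \o transport_to (class_rep_iso M)
  end.

(** Representatives of isomorphic objects are equal but not convertible. A variable [P] in place of
    the representative avoids casts, and proof irrelevance identifies the chosen isomorphisms. *)
Lemma T_map_iso M N (tau : OA_mor M N) P (h1 : OA_isomorphic M P)
    (h2 : OA_isomorphic N P) :
  OA_iso tau -> P = class_rep M ->
  T_map tau = transport_from h2 \o transport_to h1.
Proof.
move=> ti PM; subst P; rewrite /T_map; case: pselect => // h.
by rewrite (Prop_irrelevance h2 (OA_iso_class_rep h)) (Prop_irrelevance h1 (class_rep_iso M)).
Qed.

Lemma T_map_noniso M N (tau : OA_mor M N) P Q (h1 : OA_isomorphic M P)
    (h2 : OA_isomorphic N Q) :
  ~ OA_iso tau -> P = class_rep M -> Q = class_rep N ->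
  T_map tau = transport_from h2 \o section_of Q \o @retraction_of P \o transport_to h1.
Proof.
move=> ti PM QN; subst P Q; rewrite /T_map; case: pselect => // _.
by rewrite (Prop_irrelevance h2 (class_rep_iso N)) (Prop_irrelevance h1 (class_rep_iso M)).
Qed.

Lemma transport_to_continuous M P (h : OA_isomorphic M P) : continuous (transport_to h).
Proof. exact: TX_star_continuous. Qed.

Lemma transport_from_continuous M P (h : OA_isomorphic M P) :
  continuous (transport_from h).
Proof. exact: TX_star_continuous. Qed.

Lemma continuousT_comp (A B C : topologicalType) (f : A -> B) (g : B -> C) :
  continuous f -> continuous g -> continuous (g \o f).
Proof. by move=> cf cg x; apply: continuous_comp; [exact: cf|exact: cg]. Qed.

Lemma T_map_continuous M N (tau : OA_mor M N) : continuous (T_map tau).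
Proof.
rewrite /T_map; case: pselect => h.
  by apply: continuousT_comp; exact: TX_star_continuous.
apply: continuousT_comp; first exact: TX_star_continuous.
apply: continuousT_comp; first exact: retraction_of_continuous.
apply: continuousT_comp; first exact: section_of_continuous.
exact: TX_star_continuous.
Qed.

Section TmapHomotopies.
Variables (G : Type) (act : G -> X -> X).

Lemma transport_to_equivariant M P (h : OA_isomorphic M P) :
  equivariant (T_act act) (T_act act) (transport_to h).
Proof. exact: TX_star_equivariant. Qed.

Lemma transport_from_equivariant M P (h : OA_isomorphic M P) :
  equivariant (T_act act) (T_act act) (transport_from h).
Proof. exact: TX_star_equivariant. Qed.

Lemma T_map_equivariant M N (tau : OA_mor M N) :
  equivariant (T_act act) (T_act act) (T_map tau).
Proof.
rewrite /T_map; case: pselect => h g z /=.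
  by rewrite transport_to_equivariant transport_from_equivariant.
by rewrite transport_to_equivariant retraction_of_equivariant section_of_equivariant
  transport_from_equivariant.
Qed.

(** The transports leave the join coordinate untouched, so only section after retraction has to be
    compared in the full join. *)
Lemma T_map_star M N (tau : OA_mor M N) :
  Ghomotopic R (T_act act) (hocolim_act act)
    (TX_incl \o T_map tau) (star R X tau \o TX_incl).
Proof.
have cT K : continuous (@TX_incl R X r n K) by exact: set_val_continuous.
have E (K K' : OA_obj r n) (h : OA_isomorphic K K') (z : TX R X K) :
    hjoin (val (transport_to h z)) = hjoin (val z) by exact: hjoin_star.
have E' (K K' : OA_obj r n) (h : OA_isomorphic K K') (z : TX R X K') :
    hjoin (val (transport_from h z)) = hjoin (val z) by exact: hjoin_star.
apply: Ghomotopic_star_of_hjoin; [exact: T_map_continuous|exact: T_map_equivariant|].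
rewrite /T_map; case: pselect => h.
  rewrite (_ : hjoin \o _ = hjoin \o @TX_incl R X r n M); last first.
    by apply/funext => z; rewrite /TX_incl /comp E' E.
  apply: Ghomotopic_refl; first by apply: continuousT_comp; [exact: cT|exact: hjoin_continuous].
  by move=> g z; exact: hjoin_act.
set f := hjoin \o _; have -> : f = (hjoin \o (TX_incl \o (section_of (class_rep N) \o
    @retraction_of (class_rep M)))) \o transport_to (class_rep_iso M).
  by apply/funext => z; rewrite /f /TX_incl /comp E'.
have -> : hjoin \o @TX_incl R X r n M =
    (hjoin \o TX_incl) \o transport_to (class_rep_iso M).
  by apply/funext => z; rewrite /TX_incl /comp E.
apply: Ghomotopic_precomp (section_retraction_Ghomotopic act _ _).
  exact: transport_to_continuous.
exact: transport_to_equivariant.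
Qed.

Lemma transport_toK M P (h : OA_isomorphic M P) :
  Ghomotopic R (T_act act) (T_act act) (transport_from h \o transport_to h) idfun.
Proof. exact: TX_star_cancel (iso_invP h).1. Qed.

Lemma transport_fromK M P (h : OA_isomorphic M P) :
  Ghomotopic R (T_act act) (T_act act) (transport_to h \o transport_from h) idfun.
Proof. exact: TX_star_cancel (iso_invP h).2. Qed.

Lemma T_map_id M : Ghomotopic R (T_act act) (T_act act) (T_map (OA_id M)) idfun.
Proof.
rewrite (T_map_iso (class_rep_iso M) (class_rep_iso M) (OA_iso_id M))//.
exact: transport_toK.
Qed.

(** Inserts the detour from a representative to the middle object of a composite and back. *)
Lemma Ghomotopic_insert M P (h : OA_isomorphic M P) (A B : topologicalType)
    (aA : G -> A -> A) (aB : G -> B -> B) (u : A -> TX R X P) (v : TX R X P -> B) :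
  continuous u -> equivariant aA (T_act act) u ->
  continuous v -> equivariant (T_act act) aB v ->
  Ghomotopic R aA aB (v \o u) ((v \o transport_to h) \o (transport_from h \o u)).
Proof.
move=> cu eu cv ev; apply: Ghomotopic_sym.
apply: (@Ghomotopic_postcomp _ _ _ _ _ _ _ _ _ _ v cv ev).
exact: (@Ghomotopic_precomp _ _ _ _ _ _ _ _ _ _ u cu eu (transport_fromK h)).
Qed.

(** The composite is an isomorphism exactly when both factors are. In all four cases the two
    transports at [N] cancel up to homotopy; for two non-isomorphisms the inner retraction after
    section then cancels strictly. *)
Lemma T_map_comp M N L (tau : OA_mor M N) (sigma : OA_mor N L) :
  Ghomotopic R (T_act act) (T_act act)
    (T_map (OA_comp sigma tau)) (T_map sigma \o T_map tau).
Proof.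
have ct := transport_to_continuous; have cf := transport_from_continuous.
have et := transport_to_equivariant; have ef := transport_from_equivariant.
have cs := section_of_continuous; have es := section_of_equivariant act.
have cr := retraction_of_continuous; have er := retraction_of_equivariant act.
have hM := class_rep_iso M; have hN := class_rep_iso N; have hL := class_rep_iso L.
have cu : continuous (section_of (class_rep N) \o @retraction_of (class_rep M) \o
    transport_to hM).
  by apply: continuousT_comp; [exact: ct|apply: continuousT_comp; [exact: cr|exact: cs]].
have eu : equivariant (T_act act) (T_act act)
    (section_of (class_rep N) \o @retraction_of (class_rep M) \o transport_to hM).
  by move=> g z; rewrite /comp et er es.
have cv : continuous (transport_from hL \o section_of (class_rep L) \o
    @retraction_of (class_rep N)).
  by apply: continuousT_comp; [exact: cr|apply: continuousT_comp; [exact: cs|exact: cf]].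
have ev : equivariant (T_act act) (T_act act)
    (transport_from hL \o section_of (class_rep L) \o @retraction_of (class_rep N)).
  by move=> g z; rewrite /comp er es ef.
have [it|nt] := pselect (OA_iso tau); have [is_|ns] := pselect (OA_iso sigma).
- have eMN : class_rep M = class_rep N by apply: class_rep_eq; exists tau.
  have hL' : OA_isomorphic L (class_rep N) by exact: OA_iso_class_rep is_.
  have hM' : OA_isomorphic M (class_rep N) by rewrite -eMN.
  rewrite (T_map_iso hM' hL' (OA_iso_comp it is_))// (T_map_iso hM' hN it)//.
  by rewrite (T_map_iso hN hL' is_)//; apply: Ghomotopic_insert;
    [exact: ct|exact: et|exact: cf|exact: ef].
- have eMN : class_rep M = class_rep N by apply: class_rep_eq; exists tau.
  have hM' : OA_isomorphic M (class_rep N) by rewrite -eMN.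
  have nc : ~ OA_iso (OA_comp sigma tau) by move=> /OA_iso_factors[].
  rewrite (T_map_noniso hM' hL nc)// (T_map_iso hM' hN it)// (T_map_noniso hN hL ns)//.
  by apply: Ghomotopic_insert; [exact: ct|exact: et|exact: cv|exact: ev].
- have eNL : class_rep N = class_rep L by apply: class_rep_eq; exists sigma.
  have hL' : OA_isomorphic L (class_rep N) by rewrite eNL.
  have nc : ~ OA_iso (OA_comp sigma tau) by move=> /OA_iso_factors[].
  rewrite (T_map_noniso hM hL' nc)// (T_map_noniso hM hN nt)// (T_map_iso hN hL' is_)//.
  apply: (@Ghomotopic_insert _ _ hN _ _ _ _
    (section_of (class_rep N) \o @retraction_of (class_rep M) \o transport_to hM)).
  + exact: cu.
  + exact: eu.
  + exact: cf.
  + exact: ef.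
- have nc : ~ OA_iso (OA_comp sigma tau) by move=> /OA_iso_factors[].
  rewrite (T_map_noniso hM hL nc)// (T_map_noniso hM hN nt)// (T_map_noniso hN hL ns)//.
  have -> : transport_from hL \o section_of (class_rep L) \o
      @retraction_of (class_rep M) \o transport_to hM =
      (transport_from hL \o section_of (class_rep L) \o @retraction_of (class_rep N)) \o
      (section_of (class_rep N) \o @retraction_of (class_rep M) \o transport_to hM).
    by apply/funext => z; rewrite /comp section_ofK.
  by apply: Ghomotopic_insert; [exact: cu|exact: eu|exact: cv|exact: ev].
Qed.

End TmapHomotopies.

End Functor.

(** An atom serves: its label has [r - 1] elements and therefore misses exactly one slot. *)
Lemma slot_choice (r n : nat) (M : OA_obj r n) : (1 < r)%N ->
  exists pj : flats M * 'I_r,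
    flat_rk pj.1 != 0%N /\ (~: [set pj.2])%SET \subset lab M pj.1.
Proof.
move=> r1; have [|p /eqP rp _] := @atom_below _ _ (Sub (cl (mat M) [set: ground M]%SET) (cl_flat _ _) : flats M).
  by rewrite /flat_rk /= rk_cl mat_rank -lt0n; exact: ltnW.
have lp := imm_card (lab M) p.
have /subsetPn[j _ jp] : ~~ ([set: 'I_r]%SET \subset lab M p).
  by apply/negP => /subset_leq_card; rewrite cardsT card_ord lp rp leqNgt ltn_subrL (ltnW r1).
exists (p, j); rewrite rp; split=> //=.
suff /eqP -> : lab M p == (~: [set j])%SET by exact: subxx.
rewrite eqEcard cardsC1 card_ord lp rp subn1 leqnn andbT.
by apply/fintype.subsetP => k kp; rewrite !inE; apply: contraNneq jp => <-.
Qed.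

(** The maps are chosen before the action, so the same family gives both the plain and the
    equivariant functor. *)
Lemma TX_functor (R : realType) (X : topologicalType) (r n : nat) :
  exists T : forall M N : OA_obj r n, OA_mor M N -> TX R X M -> TX R X N,
  forall (G : Type) (act : G -> X -> X),
  [/\ forall M N (tau : OA_mor M N),
        [/\ continuous (T M N tau), equivariant (T_act act) (T_act act) (T M N tau)
          & Ghomotopic R (T_act act) (hocolim_act act)
              (TX_incl \o T M N tau) (star R X tau \o TX_incl)],
      forall M, Ghomotopic R (T_act act) (T_act act) (T M M (OA_id M)) idfun
    & forall M N L (tau : OA_mor M N) (sigma : OA_mor N L),
        Ghomotopic R (T_act act) (T_act act)
          (T M L (OA_comp sigma tau)) (T N L sigma \o T M N tau)].
Proof.
(* For [r] at most 1, [TX] is empty by [TX_slots], and all maps and homotopies out of it are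
   trivial. *)
have [r1|r1] := ltnP 1 r; last first.
  have E (M : OA_obj r n) (z : TX R X M) : False.
    by have [_] := TX_slots z; rewrite ltnNge r1.
  have H (M : OA_obj r n) (G : Type) (act : G -> X -> X) (B : topologicalType)
      (aB : G -> B -> B) (f g : TX R X M -> B) : Ghomotopic R (T_act act) aB f g.
    have -> : f = g by apply/funext => z; case: (E M z).
    by apply: Ghomotopic_refl => [z|k z]; case: (E M z).
  exists (fun M N tau z => False_rect _ (E M z)) => G act; split=> // M N tau.
  by split=> [z|g z|//]; case: (E M z).
pose pj (M : OA_obj r n) := sval (cid (slot_choice M r1)).
have pjP (M : OA_obj r n) : flat_rk (pj M).1 != 0%N /\
    (~: [set (pj M).2])%SET \subset lab M (pj M).1.
  exact: (svalP (cid (slot_choice M r1))).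
pose T := @T_map R X r n (Ordinal (ltnW r1)) (fun M => (pj M).1) (fun M => (pj M).2)
  (fun M => (pjP M).1) (fun M => (pjP M).2).
exists T => G act; split=> [M N tau|M|M N L tau sigma].
- by split; [exact: T_map_continuous|exact: T_map_equivariant|exact: T_map_star].
- exact: T_map_id.
- exact: T_map_comp.
Qed.

(** Inside the homotopy colimit [g] and then [f] can be replaced by the [star] maps, and these
    compose up to homotopy. *)
Lemma star_class_comp (R : realType) (X : topologicalType) (r n : nat)
    (M N L : OA_obj r n) (tau : OA_mor M N) (sigma : OA_mor N L)
    (G : Type) (act : G -> X -> X)
    (f : TX R X M -> TX R X N) (g : TX R X N -> TX R X L) :
  continuous f -> equivariant (T_act act) (T_act act) f ->
  Ghomotopic R (T_act act) (hocolim_act act)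
    (TX_incl \o f) (star R X tau \o TX_incl) ->
  Ghomotopic R (T_act act) (hocolim_act act)
    (TX_incl \o g) (star R X sigma \o TX_incl) ->
  Ghomotopic R (T_act act) (hocolim_act act)
    (TX_incl \o (g \o f)) (star R X (OA_comp sigma tau) \o TX_incl).
Proof.
move=> cf ef hf hg.
have h1 := Ghomotopic_precomp cf ef hg.
have h2 := Ghomotopic_postcomp (@star_continuous R X r n N L sigma)
  (@star_equivariant R X r n N L sigma G act) hf.
have cT : continuous (@TX_incl R X r n M) by exact: set_val_continuous.
have eT : equivariant (T_act act) (hocolim_act act) (@TX_incl R X r n M) by [].
have h3 := Ghomotopic_precomp cT eT (@star_comp_Ghomotopic R X r n M N L tau sigma G act).
exact: Ghomotopic_trans h1 (Ghomotopic_trans h2 (Ghomotopic_sym h3)).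
Qed.

Theorem theorem6 (R : realType) (r n : nat) (hrn : (r <= n)%N)
    (X : topologicalType) (hX : is_CW_complex R X) :
  (* the functor to Ho(Top) *)
  [/\ forall (M N : OA_obj r n) (tau : OA_mor M N), continuous (star R X tau),
      (forall M : OA_obj r n, homotopic R (star R X (OA_id M)) idfun) /\
      (forall (M N L : OA_obj r n) (tau : OA_mor M N) (sigma : OA_mor N L),
        homotopic R (star R X (OA_comp sigma tau))
                    (star R X sigma \o star R X tau)),
      exists T : forall M N : OA_obj r n,
          OA_mor M N -> TX R X M -> TX R X N,
        [/\ forall (M N : OA_obj r n) (tau : OA_mor M N),
              TX_class tau (T M N tau),
            forall M : OA_obj r n, homotopic R (T M M (OA_id M)) idfun
          & forall (M N L : OA_obj r n)
                (tau : OA_mor M N) (sigma : OA_mor N L),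
              homotopic R (T M L (OA_comp sigma tau))
                          (T N L sigma \o T M N tau)],
      forall (M N L : OA_obj r n) (tau : OA_mor M N) (sigma : OA_mor N L)
          (f : TX R X M -> TX R X N) (g : TX R X N -> TX R X L),
        TX_class tau f -> TX_class sigma g ->
        TX_class (OA_comp sigma tau) (g \o f)
    & forall (M N L : OA_obj r n) (tau : OA_mor M N) (sigma : OA_mor N L)
          (f : TX R X M -> TX R X N) (g : TX R X N -> TX R X L)
          (h : TX R X M -> TX R X L),
        TX_restriction tau f -> TX_restriction sigma g ->
        TX_restriction (OA_comp sigma tau) h ->
        homotopic R h (g \o f)]
  /\
  (* the functor to Gamma-Ho(Top) *)
  forall (Gamma : groupType) (act : Gamma -> X -> X),
    is_Gspace act -> free_action act ->
  [/\ forall M : OA_obj r n,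
        is_Gspace (hocolim_act (R := R) (M := M) act) /\
        is_Gspace (T_act (R := R) (M := M) act),
      (forall (M N : OA_obj r n) (tau : OA_mor M N),
        equivariant (hocolim_act act) (hocolim_act act) (star R X tau)) /\
      (forall M : OA_obj r n,
        Ghomotopic R (hocolim_act act) (hocolim_act act)
          (star R X (OA_id M)) idfun) /\
      (forall (M N L : OA_obj r n) (tau : OA_mor M N) (sigma : OA_mor N L),
        Ghomotopic R (hocolim_act act) (hocolim_act act)
          (star R X (OA_comp sigma tau)) (star R X sigma \o star R X tau)),
      exists T : forall M N : OA_obj r n,
          OA_mor M N -> TX R X M -> TX R X N,
        [/\ forall (M N : OA_obj r n) (tau : OA_mor M N),
              GTX_class tau act (T M N tau),
            forall M : OA_obj r n,
              Ghomotopic R (T_act act) (T_act act) (T M M (OA_id M)) idfun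
          & forall (M N L : OA_obj r n)
                (tau : OA_mor M N) (sigma : OA_mor N L),
              Ghomotopic R (T_act act) (T_act act)
                (T M L (OA_comp sigma tau)) (T N L sigma \o T M N tau)],
      forall (M N L : OA_obj r n) (tau : OA_mor M N) (sigma : OA_mor N L)
          (f : TX R X M -> TX R X N) (g : TX R X N -> TX R X L),
        GTX_class tau act f -> GTX_class sigma act g ->
        GTX_class (OA_comp sigma tau) act (g \o f)
    & forall (M N L : OA_obj r n) (tau : OA_mor M N) (sigma : OA_mor N L)
          (f : TX R X M -> TX R X N) (g : TX R X N -> TX R X L)
          (h : TX R X M -> TX R X L),
        TX_restriction tau f -> TX_restriction sigma g ->
        TX_restriction (OA_comp sigma tau) h ->
        Ghomotopic R (T_act act) (T_act act) h (g \o f)].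
Proof.
have [T TP] := TX_functor R X r n.
split.
  (* The plain statements are the equivariant ones over an empty type of group elements. *)
  pose act0 : void -> X -> X := fun _ => id.
  split.
  - by move=> M N tau; exact: star_continuous.
  - split=> [M|M N L tau sigma].
      by rewrite star_id; apply/(homotopic_Ghomotopic _ _ _ (hocolim_act act0) (hocolim_act act0));
        apply: Ghomotopic_refl => // z; exact: cvg_id.
    apply/(homotopic_Ghomotopic _ _ _ (hocolim_act act0) (hocolim_act act0)).
    exact: star_comp_Ghomotopic.
  - have [T1 T2 T3] := TP void act0; exists T; split=> [M N tau|M|M N L tau sigma].
    + have [cT _ hT] := T1 M N tau; split=> //.
      by apply/(homotopic_Ghomotopic _ _ _ (T_act act0) (hocolim_act act0)).
    + by apply/(homotopic_Ghomotopic _ _ _ (T_act act0) (T_act act0)).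
    + by apply/(homotopic_Ghomotopic _ _ _ (T_act act0) (T_act act0)).
  - move=> M N L tau sigma f g [cf hf] [cg hg]; split; first exact: continuousT_comp.
    apply/(homotopic_Ghomotopic _ _ _ (T_act act0) (hocolim_act act0)).
    apply: star_class_comp => //.
      exact/homotopic_Ghomotopic.
    exact/homotopic_Ghomotopic.
  - move=> M N L tau sigma f g h hf hg hh.
    apply/(homotopic_Ghomotopic _ _ _ (T_act act0) (T_act act0)).
    exact: restriction_comp_Ghomotopic hf hg hh.
move=> Gamma act hG _; have [T1 T2 T3] := TP Gamma act; split.
- by move=> M; split; [exact: hocolim_Gspace|exact: TX_Gspace].
- split; first by move=> M N tau; exact: star_equivariant.
  split=> [M|M N L tau sigma]; last exact: star_comp_Ghomotopic.
  by rewrite star_id; apply: Ghomotopic_refl => // z; exact: cvg_id.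
- by exists T.
- move=> M N L tau sigma f g [cf ef hf] [cg eg hg]; split.
  + exact: continuousT_comp.
  + by move=> k z; rewrite /comp ef eg.
  + exact: star_class_comp.
- move=> M N L tau sigma f g h hf hg hh.
  exact: restriction_comp_Ghomotopic hf hg hh.
Qed.
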